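(* Let $N=2M\geq8$ be even and not a multiple of $3$, let $\gamma>0$ be sufficiently small, and let $M'$ be the largest even number less than or equal to $M=\frac N2$. Then $$A_2\prec A'_4\prec A'_6\prec\dots\prec A'_{M'-2}\prec A'_{M'}\prec A_4\prec A_6\prec\dots\prec A_{N-2}\prec A_N$$ defines a metastable order of the families $A_p$ and $A'_p$.
   Context: For $\gamma\geq0$ let $V_\gamma(x)=\sum_{i=1}^N\bigl(\tfrac14x_i^4-\tfrac12x_i^2\bigr)+\frac\gamma4\sum_{i=1}^N(x_{i+1}-x_i)^2$ on $\mathbb{R}^N$, indices modulo $N$, and $S=\{x:\sum_ix_i=0\}$. For $\gamma=0$, $B_0$ is the set of vectors with $M$ coordinates equal to $+1$ (particles) and $M$ coordinates equal to $-1$ (holes); these are nondegenerate local minima of $V_0|_S$. For small $\gamma>0$, $B_0$ denotes the set of their continuations $x^\star(\gamma)$, which are local minima of $V_\gamma|_S$. For $x^\star\in B_0$, the number of interfaces is $I_{1/-1}(x^\star)=\#\{i:x^\star_i(0)\neq x^\star_{i+1}(0)\}$ (always even), and a site $i$ is isolated if both its neighbours satisfy $x^\star_{i\pm1}(0)\neq x^\star_i(0)$. The set $B_0$ is partitioned as follows: $A_2$ is the set of configurations with $2$ interfaces; for even $p\in\{4,\dots,M\}$, $A_p$ is the set of configurations with $p$ interfaces having at least one isolated site and $A'_p$ the set of those with $p$ interfaces having no isolated site; for even $p\in\{M+1,\dots,N\}$, $A_p$ is the set of configurations with $p$ interfaces (all of which have an isolated site). Communication height: for a local minimum $x^\star$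 and $A\subset S$, $H(x^\star,A)=\inf_{\Gamma:x^\star\to A}\sup_{t\in[0,1]}V_\gamma(\Gamma(t))-V_\gamma(x^\star)$, the infimum being over continuous paths $\Gamma:[0,1]\to S$ with $\Gamma(0)=x^\star$, $\Gamma(1)\in A$. Metastable order: disjoint sets $P_1,\dots,P_m$ of local minima (here partitioning $B_0$) are said to be in metastable order, written $P_1\prec\dots\prec P_m$, if there is a constant $\theta>0$ such that for all $k\in\{2,\dots,m\}$, all $x^\star\in P_k$ and all $\ell\in\{1,\dots,k-1\}$, $$H\Bigl(x^\star,\bigcup_{i=1}^{k-1}P_i\Bigr)\leq\min_{y^\star\in P_\ell}H\Bigl(y^\star,\bigcup_{i=1}^kP_i\setminus P_\ell\Bigr)-\theta.$$ *)

(* Defs.v *)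
From mathcomp Require Import all_boot all_order all_algebra.
From mathcomp Require Import all_classical all_reals all_analysis.
Set Implicit Arguments.
Unset Strict Implicit.
Unset Printing Implicit Defensive.
Import Order.TTheory GRing.Theory Num.Theory.
Import numFieldTopology.Exports numFieldNormedType.Exports.
Local Open Scope classical_set_scope.
Local Open Scope ring_scope.

Section Potential.
Variables (R : realType) (N : nat).
Implicit Types (g : R) (x y : 'rV[R]_N) (A : set 'rV[R]_N).

(* [ordS] and [ord_pred] are the cyclic successor and predecessor on ['I_N],
   so site indices are taken modulo [N]. *)
Definition potential g x : R :=
  \sum_i (x 0 i ^+ 4 / 4 - x 0 i ^+ 2 / 2)
  + g / 4 * \sum_i (x 0 (ordS i) - x 0 i) ^+ 2.

Definition zero_sum : set 'rV[R]_N := [set x : 'rV[R]_N | \sum_i x 0 i = 0].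

Definition local_min g : set 'rV[R]_N :=
  [set x : 'rV[R]_N | zero_sum x /\ \forall y \near within zero_sum (nbhs x), potential g x <= potential g y].

Definition paths x A : set (R -> 'rV[R]_N) :=
  [set G | [/\ {within `[0 : R, 1], continuous G},
               forall t, t \in `[0 : R, 1] -> zero_sum (G t),
               G 0 = x & A (G 1)]].

Definition comm_height g x A : \bar R :=
  (ereal_inf [set ereal_sup [set (potential g (G t))%:E | t in `[0%R : R, 1%R]]
             | G in paths x A]
   - (potential g x)%:E)%E.

(* [P_1, ..., P_m] is the list [P], numbered from 0.  The minimum over
   [P_l], which is a finite set in the intended use, is written as an infimum
   in the extended reals. *)
Definition metastable_order g (B : set 'rV[R]_N) (P : seq (set 'rV[R]_N)) :=
  [/\ B `<=` local_min g,
      \bigcup_(i in `I_(size P)) nth set0 P i = B,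
      trivIset `I_(size P) (nth set0 P)
    & exists2 theta : R, 0 < theta &
      forall k, (0 < k < size P)%N -> forall x, nth set0 P k x ->
      forall l, (l < k)%N ->
      (comm_height g x (\bigcup_(i in `I_k) nth set0 P i)
       <= ereal_inf
            [set comm_height g y
                   ((\bigcup_(i in `I_k.+1) nth set0 P i) `\` nth set0 P l)
            | y in nth set0 P l]
          - theta%:E)%E].

End Potential.

Section Configurations.
Variables (R : realType) (N : nat).
Implicit Types (g : R) (x : 'rV[R]_N) (p : nat).

Definition config (M : nat) : set 'rV[R]_N :=
  [set x : 'rV[R]_N | [/\ forall i, x 0 i = 1 \/ x 0 i = -1,
               #|[pred i | x 0 i == 1]| = M
             & #|[pred i | x 0 i == -1]| = M]].

Definition interfaces x : nat := #|[pred i | x 0 i != x 0 (ordS i)]|.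

Definition isolated_site x : pred 'I_N :=
  [pred i | (x 0 (ord_pred i) != x 0 i) && (x 0 (ordS i) != x 0 i)].

Definition config_A (M p : nat) : set 'rV[R]_N :=
  [set x : 'rV[R]_N | [/\ config M x, interfaces x = p
             & (4 <= p <= M)%N -> exists i, isolated_site x i]].

Definition config_A' (M p : nat) : set 'rV[R]_N :=
  [set x : 'rV[R]_N | [/\ config M x, interfaces x = p & ~ exists i, isolated_site x i]].

(* [x] is reached at coupling [g] by a continuous branch of local minima
   issued from [x0] at coupling 0. *)
Definition is_continuation g (x0 x : 'rV[R]_N) :=
  exists c : R -> 'rV[R]_N,
    [/\ {within `[0 : R, g], continuous c}, c 0 = x0, c g = x
      & forall s, s \in `[0, g] -> local_min s (c s)].

(* Near a configuration of [config M] such a branch exists and is unique for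
   small [g], by nondegeneracy.  The default value [x0] is taken only when
   there is no branch. *)
Definition continuation g (x0 : 'rV[R]_N) : 'rV[R]_N :=
  xget x0 (is_continuation g x0).

Definition B_0 g (M : nat) : set 'rV[R]_N := continuation g @` config M.

Definition A_ g (M p : nat) : set 'rV[R]_N := continuation g @` config_A M p.

Definition A'_ g (M p : nat) : set 'rV[R]_N := continuation g @` config_A' M p.

End Configurations.

Definition evens (a b : nat) : seq nat := [seq p <- index_iota a b.+1 | ~~ odd p].

Arguments B_0 {R} N g M.
Arguments A_ {R} N g M p.
Arguments A'_ {R} N g M p.

(* Main.v *)
Require Import Defs.
From mathcomp Require Import all_boot all_order all_algebra.
From mathcomp Require Import all_classical all_reals all_analysis.
From mathcomp Require Import perm ring lra zify.
Import Order.TTheory GRing.Theory Num.Theory.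
Import numFieldTopology.Exports numFieldNormedType.Exports.
Local Open Scope classical_set_scope.
Local Open Scope ring_scope.
Set Implicit Arguments.
Unset Strict Implicit.
Unset Printing Implicit Defensive.

(** The order is decided, at first order in [g], by the lowest saddle through
    which a path can leave the well of a configuration.

    At zero coupling the cheapest way out of a configuration [s] of particles
    (+1) and holes (-1) moves one site [i] across the middle while the other
    sites adjust. The highest point is [saddle s i], whose coordinates are the
    three roots of a cubic [x ^+ 3 - x = lam]; its height does not depend on [s]
    or [i]. For small [g] the gradient term therefore decides. On [saddle s i] it
    depends only on the number [p] of interfaces of [s] and on the number of
    neighbours of [i] of the opposite sign, recorded by [defect s i]. Subtracting
    the potential of [s] gives the barrier
      [h0 + g / (4 * den) * (2 * M^2 - 3 * p - defect s i * M * (2 * M - 3))]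
    up to order [g ^+ 2], where [den = M^2 - 3 * M + 3]. It decreases with [p],
    and it drops much more when the defect goes from 2 (the edge of a block) to
    4 (an isolated site). Ordering the families first by the presence of an
    isolated site and then by [p] thus orders the barriers ([barrier_lt]).

    The lower bound is [exit_level]. A path to another minimum leaves the region
    where every particle is above [- t], every hole is below [t] and particles
    are above holes, [- t] being the value of the moving site at the saddle.
    When a particle reaches [- t] (or a hole [t]), the saddle is the strict
    minimum on that face ([saddle_face]); when a particle meets a hole, the
    energy is larger by an amount independent of [g] ([collision]).

    For the upper bound, segments from [saddle s i] to [s] on one side, and to a
    point [relay s i] on the other, stay below the saddle up to order [g ^+ 2]
    ([config_to_relay]). The relay only depends on the pattern with [i] flipped,
    so two such half-steps exchange a particle and a hole ([swap_step]). An
    isolated site is removed by an exchange that lowers [p] by two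
    ([isolated_step]); without isolated sites, a block is shrunk from its edge
    until a site becomes isolated ([reach_isolated]). Neither ever needs a saddle
    higher than the first one, so every family but the first reaches an earlier
    one at its own barrier ([key_relax]).

    Finally, the potential is strongly convex in a box around each configuration.
    Branches of local minima cannot leave that box ([continuationP]), and their
    potential is that of the configuration up to order [g ^+ 2]. *)

(** * The potential as a well term plus a gradient term *)

Definition well {R : realType} (x : R) : R := x ^+ 4 / 4 - x ^+ 2 / 2.

Definition dirichlet {R : realType} {N : nat} (x : 'rV[R]_N) : R :=
  \sum_i (x 0 (ordS i) - x 0 i) ^+ 2.

(** Half of the gradient of [dirichlet], the discrete Laplacian up to sign. *)
Definition lap {R : realType} {N : nat} (x : 'rV[R]_N) (i : 'I_N) : R :=
  2 * x 0 i - x 0 (ordS i) - x 0 (ord_pred i).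

Definition upd {R : realType} {N : nat} (x : 'rV[R]_N) (i : 'I_N) (v : R) :=
  \row_k (if k == i then v else x 0 k) : 'rV[R]_N.

Section Algebra.
Context {R : realType} {N : nat}.
Implicit Types (g : R) (x y s d : 'rV[R]_N) (i j k : 'I_N).

Lemma potentialE g x :
  potential g x = \sum_i well (x 0 i) + g / 4 * dirichlet x.
Proof. by []. Qed.

(** Second-order Taylor formula with exact remainder. The energy
    comparisons around minima and saddles read off the sign of its last factor. *)
Lemma well_tangent (x y : R) :
  well y - well x = (x ^+ 3 - x) * (y - x)
    + (y - x) ^+ 2 * (y ^+ 2 + 2 * x * y + 3 * x ^+ 2 - 2) / 4.
Proof. by rewrite /well; field. Qed.

Lemma sum_ordS (F : 'I_N -> R) : \sum_i F (ordS i) = \sum_i F i.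
Proof. by rewrite [RHS](reindex_inj (can_inj (@ordSK N))). Qed.

Lemma dirichletD x d :
  dirichlet (x + d)
  = dirichlet x + 2 * (\sum_i lap x i * d 0 i) + dirichlet d.
Proof.
have -> : \sum_i lap x i * d 0 i
    = \sum_i (x 0 (ordS i) - x 0 i) * (d 0 (ordS i) - d 0 i).
  transitivity (\sum_i ((x 0 i - x 0 (ord_pred i)) * d 0 i
                        - (x 0 (ordS i) - x 0 i) * d 0 i)).
    by apply: eq_bigr => i _; rewrite /lap; ring.
  rewrite sumrB -[X in X - _]sum_ordS -sumrB.
  by apply: eq_bigr => i _; rewrite ordSK; ring.
rewrite /dirichlet mulr_sumr -!big_split /=.
by apply: eq_bigr => i _; rewrite !mxE; ring.
Qed.

Lemma dirichlet_ge0 x : 0 <= dirichlet x.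
Proof. by apply: sumr_ge0 => i _; rewrite sqr_ge0. Qed.

(** At a critical point of the well energy constrained to [zero_sum], the slopes
    all equal the Lagrange multiplier [lam], so the first-order terms add up to
    [lam] times a difference of sums, which is zero: an exact formula remains. *)
Lemma sum_well_tangent (lam : R) x s :
  zero_sum x -> zero_sum s -> (forall k, s 0 k ^+ 3 - s 0 k = lam) ->
  \sum_k well (x 0 k) - \sum_k well (s 0 k)
  = \sum_k (x 0 k - s 0 k) ^+ 2
      * (x 0 k ^+ 2 + 2 * s 0 k * x 0 k + 3 * s 0 k ^+ 2 - 2) / 4.
Proof.
rewrite /zero_sum /= => x0 s0 slam; rewrite -sumrB.
under [LHS]eq_bigr do rewrite well_tangent slam.
by rewrite big_split /= -mulr_sumr sumrB x0 s0 subrr mulr0 add0r.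
Qed.

Lemma ordS_neq i : (1 < N)%N -> ordS i != i.
Proof.
move=> N1; rewrite -(inj_eq val_inj) /=.
have iN := ltn_ord i.
have [E|nN] := eqVneq i.+1 N; first by rewrite E modnn; lia.
by rewrite modn_small; lia.
Qed.

Lemma ord_pred_neq i : (1 < N)%N -> ord_pred i != i.
Proof. by move=> N1; rewrite eq_sym -{1}(ord_predK i) ordS_neq. Qed.

Lemma updE x i v k : upd x i v 0 k = if k == i then v else x 0 k.
Proof. by rewrite mxE. Qed.

Lemma dirichlet_upd x i v : (1 < N)%N ->
  dirichlet (upd x i v)
  = dirichlet x + 2 * (v - x 0 i) * lap x i + 2 * (v - x 0 i) ^+ 2.
Proof.
move=> N1; set w := v - x 0 i.
pose d : 'rV[R]_N := upd 0 i w.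
have -> : upd x i v = x + d.
  apply/rowP => k; rewrite !mxE; case: eqVneq => [->|_]; last by rewrite addr0.
  by rewrite /w; ring.
rewrite dirichletD (bigD1 i) //= big1 => [|k /negPf ki]; last first.
  by rewrite /d updE ki mxE mulr0.
have -> : dirichlet d = \sum_k d 0 k * lap d k.
  have := dirichletD 0 0; have := dirichletD d (- d).
  rewrite subrr => E E0.
  have Dn : dirichlet (- d) = dirichlet d.
    by apply: eq_bigr => k _; rewrite !mxE; ring.
  have D0 : dirichlet (0 : 'rV[R]_N) = 0.
    by rewrite /dirichlet big1 // => k _; rewrite !mxE subrr expr0n.
  move: E; rewrite D0 Dn.
  have -> : \sum_k lap d k * (- d) 0 k = - \sum_k d 0 k * lap d k.
    by rewrite -sumrN; apply: eq_bigr => k _; rewrite !mxE; ring.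
  by move=> E; lra.
rewrite (bigD1 i) //= big1 => [|k /negPf ki]; last by rewrite /d updE ki mxE mul0r.
rewrite /lap /d !updE eqxx (negPf (ordS_neq i N1)) (negPf (ord_pred_neq i N1)) !mxE.
by ring.
Qed.

Lemma potentialN g x : potential g (- x) = potential g x.
Proof.
rewrite /potential; congr (_ + _ * _).
  by apply: eq_bigr => k _; rewrite !mxE; field.
by apply: eq_bigr => k _; rewrite !mxE; ring.
Qed.

Lemma zero_sumN x : zero_sum x -> zero_sum (- x).
Proof.
rewrite /zero_sum /= => x0.
by under eq_bigr do rewrite mxE; rewrite sumrN x0 oppr0.
Qed.

Lemma zero_sum_segment x y (r : R) :
  zero_sum x -> zero_sum y -> zero_sum (x + r *: (y - x)).
Proof.
rewrite /zero_sum /= => x0 y0.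
under eq_bigr do rewrite !mxE.
by rewrite big_split /= -mulr_sumr sumrB x0 y0 subrr mulr0 addr0.
Qed.

End Algebra.

(** * Linking two points below a level *)

(** The paths are continuous on all of [R], not only on the unit interval: this
    makes segments, reversal and concatenation continuous without any gluing. *)
Definition linked {R : realType} {N : nat} (g h : R) (x y : 'rV[R]_N) :=
  exists2 G : R -> 'rV[R]_N, continuous G &
    [/\ G 0 = x, G 1 = y
      & forall r, 0 <= r <= 1 -> zero_sum (G r) /\ potential g (G r) <= h].

Section Linked.
Context {R : realType} {N : nat}.
Implicit Types (g h : R) (x y z : 'rV[R]_N) (A : set 'rV[R]_N).

Let clamp (r : R) : R := Num.max 0 (Num.min 1 r).

Let clamp_continuous : continuous clamp.
Proof.
move=> r; apply: (@continuous_max R R (cst 0) (fun r => Num.min 1 r)).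
  exact: cvg_cst.
by apply: (@continuous_min R R (cst 1) id); [exact: cvg_cst | exact: cvg_id].
Qed.

Let clamp_id r : 0 <= r <= 1 -> clamp r = r.
Proof. by move=> /andP[r0 r1]; rewrite /clamp min_r // max_r. Qed.

Let clamp0 r : r <= 0 -> clamp r = 0.
Proof. by move=> r0; rewrite /clamp min_r ?max_l //; lra. Qed.

Let clamp1 r : 1 <= r -> clamp r = 1.
Proof. by move=> r0; rewrite /clamp min_l // max_r. Qed.

(** Concatenation is the sum of both paths, run with a clamped clock, minus their
    common point: at each time one of the two paths is at rest at that point. *)
Lemma linked_trans g h y x z : linked g h x y -> linked g h y z -> linked g h x z.
Proof.
move=> [F cF [F0 F1 FP]] [G cG [G0 G1 GP]].
pose K r := F (clamp (2 * r)) + G (clamp (2 * r - 1)) - y.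
have Kl r : r <= 1 / 2 -> K r = F (clamp (2 * r)).
  by move=> r2; rewrite /K (clamp0 (r := 2 * r - 1)) ?G0 ?addrK //; lra.
have Kr r : 1 / 2 <= r -> K r = G (clamp (2 * r - 1)).
  by move=> r2; rewrite /K (clamp1 (r := 2 * r)) ?F1 1?addrC ?addKr //; lra.
exists K.
  move=> r; apply: cvgB; last exact: cvg_cst.
  apply: cvgD.
    apply: (continuous_comp (f := fun r : R => clamp (2 * r)) (g := F)); last exact: cF.
    apply: (continuous_comp (f := fun r : R => 2 * r) (g := clamp)); last exact: clamp_continuous.
    by apply: cvgM; [exact: cvg_cst | exact: cvg_id].
  apply: (continuous_comp (f := fun r : R => clamp (2 * r - 1)) (g := G)); last exact: cG.
  apply: (continuous_comp (f := fun r : R => 2 * r - 1) (g := clamp)); last exact: clamp_continuous.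
  apply: cvgB; last exact: cvg_cst.
  by apply: cvgM; [exact: cvg_cst | exact: cvg_id].
split.
- by rewrite Kl ?mulr0 ?clamp_id ?F0 //; lra.
- by rewrite Kr ?clamp_id ?mulr1 //; [rewrite -G1; congr G | |]; lra.
- move=> r /andP[r0 r1]; have [r2|r2] := leP r (1 / 2).
    by rewrite Kl // clamp_id; [apply: FP|]; lra.
  by rewrite Kr ?clamp_id; [apply: GP| |]; lra.
Qed.

Lemma linked_sym g h x y : linked g h x y -> linked g h y x.
Proof.
move=> [G cG [G0 G1 GP]]; exists (fun r => G (1 - r)).
  move=> r; apply: (continuous_comp (f := fun r : R => 1 - r) (g := G)); last exact: cG.
  by apply: cvgB; [exact: cvg_cst | exact: cvg_id].
split; rewrite ?subr0 ?subrr // => r r01; apply: GP; lra.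
Qed.

Lemma linked_le g h h' x y : h <= h' -> linked g h x y -> linked g h' x y.
Proof.
move=> hh' [G cG [G0 G1 GP]]; exists G => //; split=> // r /GP[Gz Gh].
by split=> //; exact: le_trans hh'.
Qed.

Lemma linked_opp g h x y : linked g h (- x) (- y) -> linked g h x y.
Proof.
move=> [G cG [G0 G1 GP]]; exists (fun r => - G r).
  by move=> r; apply: cvgN; exact: cG.
split; rewrite ?G0 ?G1 ?opprK // => r /GP[Gz Gh].
by rewrite potentialN; split=> //; exact: zero_sumN.
Qed.

Lemma linked_segment g h x y : zero_sum x -> zero_sum y ->
  (forall r, 0 <= r <= 1 -> potential g (x + r *: (y - x)) <= h) ->
  linked g h x y.
Proof.
move=> x0 y0 Ph; exists (fun r => x + r *: (y - x)).
  move=> r; apply: cvgD; first exact: cvg_cst.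
  by apply: cvgZr_tmp; exact: cvg_id.
split; rewrite ?scale0r ?addr0 ?scale1r ?subrKC //.
by move=> r r01; split; [exact: zero_sum_segment | exact: Ph].
Qed.

Lemma comm_height_le g h x y A : linked g h x y -> A y ->
  (comm_height g x A <= (h - potential g x)%:E)%E.
Proof.
move=> [G cG [G0 G1 GP]] Ay; rewrite /comm_height EFinB leeB //.
apply: (@le_trans _ _ (ereal_sup [set (potential g (G t))%:E | t in `[0%R : R, 1%R]])).
  apply: ereal_inf_lbound; exists G => //; split => //.
  - exact: continuous_subspaceT.
  - by move=> t; rewrite in_itv /= => /GP[].
  - by rewrite G1.
apply: ge_ereal_sup => _ [t t01 <-]; rewrite lee_fin.
by move: t01; rewrite /= in_itv /= => /GP[].
Qed.

Lemma comm_height_ge g h x A :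
  (forall G, paths x A G -> exists2 r, 0 <= r <= 1 & h <= potential g (G r)) ->
  ((h - potential g x)%:E <= comm_height g x A)%E.
Proof.
move=> hG; rewrite /comm_height EFinB leeB //.
apply: le_ereal_inf_tmp => _ [G /hG[r r01 hr] <-].
apply: (@le_trans _ _ (potential g (G r))%:E); first by rewrite lee_fin.
by apply: ereal_sup_ubound; exists r => //; rewrite /= in_itv.
Qed.

Lemma bigmin_continuous (T : topologicalType) (I : Type) (s : seq I)
    (f : I -> T -> R) :
  (forall k, continuous (f k)) ->
  continuous (fun r => \big[Num.min/1]_(k <- s) f k r).
Proof.
move=> cf; elim: s => [|k s IH].
  by under eq_fun do rewrite big_nil; move=> r; exact: cvg_cst.
under eq_fun do rewrite big_cons.
by move=> r; apply: continuous_min; [exact: cf | exact: IH].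
Qed.

(** First-exit principle: a path that leaves the region where all [f k] are
    nonnegative hits its boundary while still in that region. It is the
    intermediate value theorem for the minimum of the family. *)
Lemma first_exit (a b : R) (K : finType) (f : K -> R -> R) (k0 : K) : a <= b ->
  (forall k, {within `[a, b], continuous (f k)}) ->
  (forall k, 0 < f k a) -> f k0 b <= 0 ->
  exists2 r, a <= r <= b & (forall k, 0 <= f k r) /\ exists k, f k r = 0.
Proof.
move=> ab cf f0 f1; pose F r := \big[Num.min/1]_k f k r.
have cF : {within `[a, b], continuous F}.
  have := @bigmin_continuous (subspace [set` `[a, b]]) K (index_enum K) f cf.
  by [].
have F0 : 0 <= F a by apply/bigmin_geP; split => [|k _]; rewrite ?ler01 ?ltW.
have F1 : F b <= 0 by apply: le_trans f1; exact: (bigmin_le 1 k0 (f^~ b)).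
have [|r r01 Fr] := IVT (v := 0) ab cF.
  by rewrite ge_min F1 orbT le_max F0.
exists r; first by rewrite in_itv in r01.
split=> [k|]; first by rewrite -Fr; exact: (bigmin_le 1 k (f^~ r)).
apply: contrapT => nk.
suff : 0 < F r by rewrite Fr ltxx.
apply/bigmin_gtP; split=> [|k _]; first exact: ltr01.
have := bigmin_le 1 k (f^~ r).
rewrite -/(F r) Fr le_eqVlt => /orP[/eqP E|//].
by case: nk; exists k.
Qed.

End Linked.

(** * Strong convexity near a configuration *)

Definition pm1 {R : realType} {N : nat} (x : 'rV[R]_N) :=
  forall k, x 0 k = 1 \/ x 0 k = -1.

(** Around a configuration of +1s and -1s, all coordinates in this box have modulus
    at least 3/4, where the one-site well has second derivative at least 11/16. *)
Definition well_box {R : realType} {N : nat} (s : 'rV[R]_N) : set 'rV[R]_N :=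
  [set x | zero_sum x /\ forall k, `|x 0 k - s 0 k| <= 1 / 4].

Section Wells.
Context {R : realType} {N : nat}.
Implicit Types (g r : R) (x y z s : 'rV[R]_N).

Let curv_ge1 (e x z : R) : e = 1 \/ e = -1 -> `|x - e| <= 1 / 4 ->
  `|z - e| <= 1 / 4 -> 1 <= x ^+ 2 + 2 * z * x + 3 * z ^+ 2 - 2.
Proof. by rewrite !ler_norml => -[->|->]; nra. Qed.

Lemma well_jensen (e x y r : R) : e = 1 \/ e = -1 -> `|x - e| <= 1 / 4 ->
  `|y - e| <= 1 / 4 -> 0 <= r <= 1 ->
  well (x + r * (y - x))
  <= (1 - r) * well x + r * well y - r * (1 - r) / 4 * (y - x) ^+ 2.
Proof.
move=> e1 xe ye /andP[r0 r1]; set z := x + r * (y - x).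
have r1' : 0 <= 1 - r by rewrite subr_ge0.
have ze : `|z - e| <= 1 / 4.
  have -> : z - e = (1 - r) * (x - e) + r * (y - e) by rewrite /z; ring.
  rewrite (le_trans (ler_normD _ _)) // !normrM !(ger0_norm r0) (ger0_norm r1').
  by have := lerD (ler_wpM2l r1' xe) (ler_wpM2l r0 ye); lra.
have qx := curv_ge1 e1 xe ze; have qy := curv_ge1 e1 ye ze.
have Tx := well_tangent z x; have Ty := well_tangent z y.
have Bx : well z + (z ^+ 3 - z) * (x - z) + (x - z) ^+ 2 / 4 <= well x.
  have : 0 <= (x - z) ^+ 2 * (x ^+ 2 + 2 * z * x + 3 * z ^+ 2 - 2 - 1).
    by rewrite mulr_ge0 ?sqr_ge0 // subr_ge0.
  by lra.
have By : well z + (z ^+ 3 - z) * (y - z) + (y - z) ^+ 2 / 4 <= well y.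
  have : 0 <= (y - z) ^+ 2 * (y ^+ 2 + 2 * z * y + 3 * z ^+ 2 - 2 - 1).
    by rewrite mulr_ge0 ?sqr_ge0 // subr_ge0.
  by lra.
have := lerD (ler_wpM2l r1' Bx) (ler_wpM2l r0 By).
set l := (z ^+ 3 - z).
have -> : (1 - r) * (well z + l * (x - z) + (x - z) ^+ 2 / 4)
   + r * (well z + l * (y - z) + (y - z) ^+ 2 / 4)
   = well z + r * (1 - r) / 4 * (y - x) ^+ 2.
  by rewrite /l; move: (well z) => w; rewrite /z; field.
by lra.
Qed.

Lemma dirichlet_convex x y r : 0 <= r <= 1 ->
  dirichlet (x + r *: (y - x)) <= (1 - r) * dirichlet x + r * dirichlet y.
Proof.
move=> /andP[r0 r1]; rewrite /dirichlet !mulr_sumr -big_split /=.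
apply: ler_sum => k _; rewrite !mxE.
set u := x 0 (ordS k); set v := x 0 k; set p := y 0 _; set q := y 0 _.
rewrite -subr_ge0.
have -> : (1 - r) * (u - v) ^+ 2 + r * (p - q) ^+ 2
   - (u + r * (p - u) - (v + r * (q - v))) ^+ 2
   = r * (1 - r) * ((u - v) - (p - q)) ^+ 2 by ring.
by apply: mulr_ge0; [apply: mulr_ge0 => //; lra | exact: sqr_ge0].
Qed.

(** The quadratic gain comes from the wells alone, the gradient term being
    convex. It drives uniqueness, stability and continuity of the minima. *)
Lemma potential_jensen g s x y r : 0 <= g -> pm1 s ->
  well_box s x -> well_box s y -> 0 <= r <= 1 ->
  potential g (x + r *: (y - x))
  <= (1 - r) * potential g x + r * potential g y
     - r * (1 - r) / 4 * \sum_k (y 0 k - x 0 k) ^+ 2.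
Proof.
move=> g0 p1 [_ bx] [_ by_] r01; rewrite !potentialE.
have W : \sum_k well ((x + r *: (y - x)) 0 k) <= (1 - r) * \sum_k well (x 0 k)
   + r * \sum_k well (y 0 k) - r * (1 - r) / 4 * \sum_k (y 0 k - x 0 k) ^+ 2.
  rewrite !mulr_sumr -big_split -sumrB /=; apply: ler_sum => k _; rewrite !mxE.
  exact: well_jensen (p1 k) (bx k) (by_ k) r01.
have g4 : 0 <= g / 4 by lra.
by have := ler_wpM2l g4 (dirichlet_convex x y r01); lra.
Qed.

Lemma sum_well_pm1 s : pm1 s -> \sum_k well (s 0 k) = - (N%:R / 4).
Proof.
move=> p1; rewrite (eq_bigr (fun=> - (1 / 4))).
  by rewrite sumr_const card_ord -mulr_natr; lra.
by move=> k _; rewrite /well; case: (p1 k) => ->; field.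
Qed.

Lemma dirichlet_pm1_le s : pm1 s -> dirichlet s <= 4 * N%:R.
Proof.
move=> p1; rewrite mulr_natr /dirichlet -[in leRHS](card_ord N) -sumr_const.
by apply: ler_sum => k _; case: (p1 k) => ->; case: (p1 (ordS k)) => ->; lra.
Qed.

Lemma well_box_quad s x : pm1 s -> well_box s x ->
  \sum_k (x 0 k - s 0 k) ^+ 2 / 2 - N%:R / 4 <= \sum_k well (x 0 k).
Proof.
move=> p1 [_ bx]; rewrite -(sum_well_pm1 p1) -big_split /=.
apply: ler_sum => k _; move: (bx k).
set v := x 0 k; rewrite ler_norml /well; case: (p1 k) => -> /andP[v1 v2].
  have : 0 <= (v - 1) ^+ 2 * ((v + 1) ^+ 2 - 2).
    by apply: mulr_ge0; [exact: sqr_ge0 | nra].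
  by lra.
have : 0 <= (v + 1) ^+ 2 * ((v - 1) ^+ 2 - 2).
  by apply: mulr_ge0; [exact: sqr_ge0 | nra].
by lra.
Qed.

(** A point of the box below the configuration [s] cannot be far from it, since
    leaving [s] costs a square while the gradient term gains at most [g * N]. *)
Lemma near_pm1 g s x : 0 <= g -> pm1 s -> well_box s x ->
  potential g x <= potential g s ->
  forall k, (x 0 k - s 0 k) ^+ 2 <= 2 * g * N%:R.
Proof.
move=> g0 p1 bx; rewrite !potentialE (sum_well_pm1 p1) => Vx k.
have Q := well_box_quad p1 bx.
have D0 := dirichlet_ge0 x; have D1 := dirichlet_pm1_le p1.
have : (x 0 k - s 0 k) ^+ 2 / 2 <= \sum_k (x 0 k - s 0 k) ^+ 2 / 2.
  rewrite (bigD1 k) //= lerDl; apply: sumr_ge0 => i _.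
  by rewrite divr_ge0 ?sqr_ge0.
have : 0 <= g / 4 * dirichlet x by rewrite mulr_ge0 //; lra.
have : g / 4 * dirichlet s <= g / 4 * (4 * N%:R) by rewrite ler_wpM2l //; lra.
by lra.
Qed.

(** The gradient at [s] has size of order [g], and the wells grow quadratically:
    completing the square bounds the gain by order [g ^+ 2]. *)
Lemma potential_well_ge g s x : 0 <= g -> pm1 s -> well_box s x ->
  potential g s - 2 * N%:R * g ^+ 2 <= potential g x.
Proof.
move=> g0 p1 bx; have := well_box_quad p1 bx.
rewrite !potentialE (sum_well_pm1 p1).
have -> : x = s + (x - s) by rewrite subrKC.
rewrite dirichletD.
have -> : \sum_k ((s + (x - s)) 0 k - s 0 k) ^+ 2 / 2
   = \sum_k ((x - s) 0 k) ^+ 2 / 2.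
  by apply: eq_bigr => k _; rewrite !mxE; congr (_ ^+ 2 / _); ring.
set d := x - s.
have : - (2 * N%:R * g ^+ 2) <= \sum_k (d 0 k) ^+ 2 / 2
    + g / 4 * (2 * \sum_k lap s k * d 0 k).
  rewrite !mulr_sumr -big_split /=.
  have -> : - (2 * N%:R * g ^+ 2) = \sum_(k < N) (- (2 * g ^+ 2)).
    by rewrite sumr_const card_ord -mulr_natr; ring.
  apply: ler_sum => k _.
  have l4 : lap s k ^+ 2 <= 16.
    by rewrite /lap; case: (p1 k) => ->; case: (p1 (ordS k)) => ->; case: (p1 (ord_pred k)) => ->; lra.
  have := sqr_ge0 (d 0 k + g / 2 * lap s k).
  have : g ^+ 2 * lap s k ^+ 2 <= g ^+ 2 * 16 by rewrite ler_wpM2l ?sqr_ge0.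
  by lra.
have : 0 <= g / 4 * dirichlet d by rewrite mulr_ge0 ?dirichlet_ge0 //; lra.
by lra.
Qed.

(** By convexity, a lower point [y] of the box would make the potential decrease
    along the segment from [x] to [y], arbitrarily close to [x]. *)
Lemma local_min_well_le g s x y : 0 <= g -> pm1 s -> local_min g x ->
  well_box s x -> well_box s y -> potential g x <= potential g y.
Proof.
move=> g0 p1 [xz lx] bx by_; rewrite leNgt; apply/negP => yx.
pose c r := x + r *: (y - x).
have c0 : c 0 = x by rewrite /c scale0r addr0.
have : \forall r \near (0 : R), zero_sum (c r) -> potential g x <= potential g (c r).
  have cc : {for 0, continuous c}.
    apply: cvgD; first exact: cvg_cst.
    by apply: cvgZr_tmp; exact: cvg_id.
  apply: (cc (fun y => zero_sum y -> potential g x <= potential g y)).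
  by rewrite c0; exact: lx.
move=> /nbhs_ballP[e /= e0 ce].
pose r := Num.min 1 (e / 2).
have r0 : 0 < r by rewrite lt_min ltr01 divr_gt0.
have r1 : r <= 1 by rewrite ge_min lexx.
have re : r < e.
  have : r <= e / 2 by rewrite ge_min lexx orbT.
  by lra.
have := ce r; rewrite /ball /= sub0r normrN gtr0_norm // => /(_ re).
have yz := by_.1; move=> /(_ (zero_sum_segment r xz yz)).
have r01 : 0 <= r <= 1 by rewrite ltW.
have := potential_jensen g0 p1 bx by_ r01.
rewrite -/(c r).
have : 0 <= r * (1 - r) / 4 * \sum_k (y 0 k - x 0 k) ^+ 2.
  apply: mulr_ge0; last by apply: sumr_ge0 => k _; exact: sqr_ge0.
  by apply: divr_ge0 => //; apply: mulr_ge0; lra.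
have : r * potential g y < r * potential g x by rewrite ltr_pM2l.
by lra.
Qed.

Lemma sum_continuous (T : topologicalType) (I : Type) (l : seq I)
    (f : I -> T -> R) :
  (forall k, continuous (f k)) -> continuous (fun t => \sum_(k <- l) f k t).
Proof.
move=> cf; elim: l => [|k l IH].
  by under eq_fun do rewrite big_nil; move=> t; exact: cvg_cst.
under eq_fun do rewrite big_cons.
by move=> t; apply: cvgD; [exact: cf | exact: IH].
Qed.

Lemma well_box_compact s : compact (well_box s).
Proof.
pose B := [set v : 'rV[R]_N | forall i, [set` `[s 0 i - 1 / 4, s 0 i + 1 / 4]] (v ord0 i)].
have cB : compact B.
  apply: (rV_compact (A := fun i => `[s 0 i - 1 / 4, s 0 i + 1 / 4]%classic)) => i.
  exact: segment_compact.
have -> : well_box s = B `&` @zero_sum R N.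
  apply/seteqP; split=> x.
    move=> [xz bx]; split=> // i; have := bx i.
    by rewrite /= in_itv /= ler_norml; lra.
  move=> [bx xz]; split=> // i; have := bx i.
  by rewrite /= in_itv /= ler_norml; lra.
apply: compact_closedI => //.
have -> : @zero_sum R N = (fun x : 'rV[R]_N => \sum_i x 0 i) @^-1` [set 0] by [].
apply: preimage_closed; last exact: closed_eq.
move=> x _.
exact: (@sum_continuous _ _ (index_enum 'I_N) _ (fun i => @coord_continuous R 1 N 0 i) x).
Qed.

Lemma potential_continuous g : continuous (@potential R N g).
Proof.
have cX n (f : 'rV[R]_N -> R) : continuous f -> continuous (fun x => f x ^+ n).
  move=> cf x; apply: (continuous_comp (g := fun r : R => r ^+ n)) (cf x) _.
  exact: exprn_continuous.
have cc k : continuous (fun x : 'rV[R]_N => x 0 k) by exact: coord_continuous.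
have cW k : continuous (fun x : 'rV[R]_N => well (x 0 k)).
  move=> x; apply: (continuous_comp (g := @well R)) (cc k x) _.
  by apply: cvgB; apply: cvgM; [exact: exprn_continuous | exact: cvg_cst
                             | exact: exprn_continuous | exact: cvg_cst].
have cD k : continuous (fun x : 'rV[R]_N => (x 0 (ordS k) - x 0 k) ^+ 2).
  apply: (cX 2%N (fun x : 'rV[R]_N => x 0 (ordS k) - x 0 k)) => x.
  exact: cvgB (cc (ordS k) x) (cc k x).
move=> x.
have HW := @sum_continuous _ _ (index_enum 'I_N) _ cW x.
have HD := @sum_continuous _ _ (index_enum 'I_N) _ cD x.
exact: cvgD HW (cvgM (cvg_cst (g / 4)) HD).
Qed.

Lemma well_argmin g s : zero_sum s ->
  exists2 x, well_box s x & forall y, well_box s y -> potential g x <= potential g y.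
Proof.
move=> x0z.
have b0 : well_box s !=set0.
  by exists s; split=> // k; rewrite subrr normr0; lra.
have cV : {within well_box s, continuous (potential g)}.
  by apply: continuous_subspaceT; exact: potential_continuous.
have [x xb xm] := EVT_min_rV b0 (@well_box_compact s) cV.
exists x; first by rewrite inE in xb.
by move=> y yb; apply: xm; rewrite inE.
Qed.

End Wells.

(** * The branch of minima issued from a configuration *)

Section Continuation.
Context {R : realType} {N : nat}.
Implicit Types (g r : R) (x y z s : 'rV[R]_N).

Lemma well_box_refl s : zero_sum s -> well_box s s.
Proof. by move=> sz; split=> // k; rewrite subrr normr0; lra. Qed.

Lemma well_box_segment s x y r : 0 <= r <= 1 ->
  well_box s x -> well_box s y -> well_box s (x + r *: (y - x)).
Proof.
move=> /andP[r0 r1] [xz bx] [yz by_]; split; first exact: zero_sum_segment.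
move=> k; rewrite !mxE.
have -> : x 0 k + r * (y 0 k - x 0 k) - s 0 k
    = (1 - r) * (x 0 k - s 0 k) + r * (y 0 k - s 0 k) by ring.
have r1' : 0 <= 1 - r by lra.
rewrite (le_trans (ler_normD _ _)) // !normrM (ger0_norm r0) (ger0_norm r1').
by have := lerD (ler_wpM2l r1' (bx k)) (ler_wpM2l r0 (by_ k)); lra.
Qed.

(** Compare the minimizer with the midpoint of [x] and [y]. *)
Lemma well_argmin_gap g s x y : 0 <= g -> pm1 s -> well_box s x ->
  (forall z, well_box s z -> potential g x <= potential g z) -> well_box s y ->
  potential g x + 1 / 8 * \sum_k (y 0 k - x 0 k) ^+ 2 <= potential g y.
Proof.
move=> g0 p1 bx xmin by_.
have h01 : 0 <= (1 / 2 : R) <= 1 by apply/andP; split; lra.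
have := xmin _ (well_box_segment h01 bx by_).
by have := potential_jensen g0 p1 bx by_ h01; lra.
Qed.

Lemma dirichlet_well_box s x : pm1 s -> well_box s x -> dirichlet x <= 7 * N%:R.
Proof.
move=> p1 [_ bx]; rewrite mulr_natr /dirichlet -[in leRHS](card_ord N) -sumr_const.
apply: ler_sum => k _; move: (bx k) (bx (ordS k)); rewrite !ler_norml.
by case: (p1 k) => ->; case: (p1 (ordS k)) => ->; nra.
Qed.

(** Each minimizer loses a square of the distance when used at the other's
    coupling; adding both losses leaves only the variation of the gradient
    term, which is linear in the coupling. *)
Lemma well_argmin_holder g g' s x x' : 0 <= g -> 0 <= g' -> pm1 s ->
  well_box s x -> (forall z, well_box s z -> potential g x <= potential g z) ->
  well_box s x' -> (forall z, well_box s z -> potential g' x' <= potential g' z) ->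
  \sum_k (x' 0 k - x 0 k) ^+ 2 <= 7 * N%:R * `|g - g'|.
Proof.
move=> g0 g0' p1 bx xm bx' xm'.
have := well_argmin_gap g0 p1 bx xm bx'.
have := well_argmin_gap g0' p1 bx' xm' bx.
have -> : \sum_k (x 0 k - x' 0 k) ^+ 2 = \sum_k (x' 0 k - x 0 k) ^+ 2.
  by apply: eq_bigr => k _; ring.
set S := \sum_k _; rewrite !potentialE => E1 E2.
have D := dirichlet_well_box p1 bx; have D' := dirichlet_well_box p1 bx'.
have P := dirichlet_ge0 x; have P' := dirichlet_ge0 x'.
have : (g - g') * (dirichlet x' - dirichlet x) <= `|g - g'| * (7 * N%:R).
  rewrite (le_trans (ler_norm _)) // normrM ler_wpM2l //.
  by rewrite ler_norml; lra.
by lra.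
Qed.

Let sqr_small (a : R) : a ^+ 2 < 1 / 64 -> `|a| < 1 / 8.
Proof. by move=> h; rewrite ltr_norml; nra. Qed.

Lemma argmin_local_min g s x : well_box s x ->
  (forall z, well_box s z -> potential g x <= potential g z) ->
  (forall k, `|x 0 k - s 0 k| < 1 / 8) -> local_min g x.
Proof.
move=> [xz bx] xm xk; split=> //.
have e0 : 0 < 1 / 8 :> R by lra.
have : \forall y \near x, ball x (1 / 8) y by exact: nbhsx_ballx.
apply: filterS => y [_ xy] yz; apply: xm; split=> // k.
have := xy 0 k; rewrite /ball /= => xyk; have := xk k.
move: xyk; rewrite ltr_norml => /andP[a1 a2]; rewrite ltr_norml => /andP[b1 b2].
by rewrite ler_norml; lra.
Qed.

Lemma argmin_branch s : pm1 s -> zero_sum s ->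
  exists2 c : R -> 'rV[R]_N, continuous c &
    forall r, 0 <= r -> well_box s (c r)
      /\ forall z, well_box s z -> potential r (c r) <= potential r z.
Proof.
move=> p1 sz.
have ex r : exists x, well_box s x
    /\ forall z, well_box s z -> potential `|r| x <= potential `|r| z.
  by have [x ? ?] := well_argmin `|r| sz; exists x.
have [c cP] := choice ex.
exists c; last by move=> r r0; have := cP r; rewrite ger0_norm.
move=> r; apply/cvg_ballP => e e0.
have d0 : 0 < e ^+ 2 / (7 * N%:R + 1).
  by rewrite divr_gt0 ?exprn_gt0 // ltr_wpDl // mulr_ge0.
have : \forall r' \near r, ball r (e ^+ 2 / (7 * N%:R + 1)) r'.
  exact: nbhsx_ballx.
apply: filterS => r'; rewrite /ball /= ltr_pdivlMr; last first.
  by rewrite ltr_wpDl // mulr_ge0.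
move=> rr'; split=> // i k; rewrite (ord1 i).
have [b m] := cP r; have [b' m'] := cP r'.
have := well_argmin_holder (normr_ge0 r) (normr_ge0 r') p1 b m b' m'.
have : (c r' 0 k - c r 0 k) ^+ 2 <= \sum_k (c r' 0 k - c r 0 k) ^+ 2.
  by rewrite (bigD1 k) //= lerDl; apply: sumr_ge0 => j _; exact: sqr_ge0.
have : 7 * N%:R * `| `|r| - `|r'| | <= 7 * N%:R * `|r - r'|.
  by rewrite ler_wpM2l ?mulr_ge0 // ler_dist_dist.
have N0 : 0 <= `|r - r'| by [].
move=> h1 h2 h3; have : (c r' 0 k - c r 0 k) ^+ 2 < e ^+ 2 by lra.
rewrite /ball /= distrC -(real_normK (num_real (c r' 0 k - c r 0 k))).
by rewrite ltr_pXn2r // nnegrE // ltW.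
Qed.

(** The bound on [g] makes the square in [near_pm1] smaller than [1 / 64], so
    that low points of the box stay within half its radius. *)
Lemma local_min_well_small g s x : 0 <= g -> 2 * g * N%:R < 1 / 64 ->
  pm1 s -> zero_sum s -> well_box s x ->
  local_min g x \/ (forall z, well_box s z -> potential g x <= potential g z) ->
  potential g x <= potential g s /\ forall k, `|x 0 k - s 0 k| < 1 / 8.
Proof.
move=> g0 gN p1 sz bx xm.
have bs := well_box_refl sz.
have xs : potential g x <= potential g s.
  by case: xm => [xm|]; [exact: local_min_well_le p1 xm bx bs | apply].
split=> // k; apply: sqr_small; apply: le_lt_trans gN.
exact: near_pm1 g0 p1 bx xs k.
Qed.

Lemma is_continuation_ex g s : 0 <= g -> 2 * g * N%:R < 1 / 64 ->
  pm1 s -> zero_sum s -> exists x, is_continuation g s x.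
Proof.
move=> g0 gN p1 sz; have [c cc cP] := argmin_branch p1 sz.
exists (c g); exists c; split=> //.
- exact: continuous_subspaceT.
- have [b m] := cP 0 (lexx 0).
  have := near_pm1 (lexx 0) p1 b (m _ (well_box_refl sz)).
  rewrite mulr0 mul0r => h; apply/rowP => k; apply/eqP.
  by rewrite -subr_eq0 -sqrf_eq0 eq_le h sqr_ge0.
- move=> r; rewrite in_itv /= => /andP[r0 rg].
  have [b m] := cP r r0.
  have rN : 2 * r * N%:R < 1 / 64.
    by apply: le_lt_trans gN; rewrite ler_wpM2r //; lra.
  apply: (argmin_local_min b m).
  by have [] := local_min_well_small r0 rN p1 sz b (or_intror m).
Qed.

(** Any branch of local minima starting at [s] stays in the box: to leave it, a
    coordinate would have to be at distance 3/16 from [s] at some coupling, while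
    local minima in the box keep within 1/8. *)
Lemma is_continuation_well g s x : 0 <= g -> 2 * g * N%:R < 1 / 64 ->
  pm1 s -> zero_sum s -> is_continuation g s x -> well_box s x.
Proof.
move=> g0 gN p1 sz [c [cc c0 cg cm]]; rewrite -cg.
have gin : g \in `[0, g] by rewrite in_itv /= g0 lexx.
split; first by have [] := cm g gin.
move=> k; rewrite leNgt; apply/negP => far.
pose f (k : 'I_N) r := (3 / 16) ^+ 2 - (c r 0 k - s 0 k) ^+ 2.
have cf j : {within `[0, g], continuous (f j)}.
  have cj : {within `[0, g], continuous (fun r => c r 0 j)}.
    move=> r; apply: (@continuous_comp (subspace [set` `[0, g]]) 'rV[R]_N R c
      (fun x => x 0 j) r (cc r)).
    exact: coord_continuous.
  move=> r; apply: cvgB; first exact: cvg_cst.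
  apply: (@continuous_comp (subspace [set` `[0, g]]) R R
    (fun r => c r 0 j - s 0 j) (fun u : R => u ^+ 2)); last exact: exprn_continuous.
  by apply: cvgB; [exact: cj | exact: cvg_cst].
have f0 j : 0 < f j 0 by rewrite /f c0 subrr expr0n subr0 exprn_gt0 //; lra.
have fk : f k g <= 0.
  rewrite /f subr_le0 -(real_normK (num_real (c g 0 k - s 0 k))).
  by rewrite ler_pXn2r // ?nnegrE //; lra.
have [r r0g [fr [j fj]]] := first_exit g0 cf f0 fk.
have /andP[r0 rg] := r0g.
have rin : r \in `[0, g] by rewrite in_itv.
have b : well_box s (c r).
  split; first by have [] := cm r rin.
  by move=> i; have := fr i; rewrite /f ler_norml; nra.
have rN : 2 * r * N%:R < 1 / 64.
  by apply: le_lt_trans gN; rewrite ler_wpM2r //; lra.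
have [_ /(_ j)] := local_min_well_small r0 rN p1 sz b (or_introl (cm r rin)).
by move: fj; rewrite /f ltr_norml; nra.
Qed.

Lemma continuationP g s (m := continuation g s) : 0 <= g -> 2 * g * N%:R < 1 / 64 ->
  pm1 s -> zero_sum s ->
  [/\ local_min g m, well_box s m, forall k, `|m 0 k - s 0 k| < 1 / 8
    & potential g m <= potential g s].
Proof.
move=> g0 gN p1 sz.
have mP : is_continuation g s m.
  by rewrite /m /continuation; apply: xgetPex; exact: is_continuation_ex.
have b := is_continuation_well g0 gN p1 sz mP.
have lm : local_min g m.
  by case: mP => c [_ _ <-]; apply; rewrite in_itv /= g0 lexx.
by have [? ?] := local_min_well_small g0 gN p1 sz b (or_introl lm).
Qed.

Lemma linked_continuation g s : 0 <= g -> 2 * g * N%:R < 1 / 64 ->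
  pm1 s -> zero_sum s -> linked g (potential g s) (continuation g s) s.
Proof.
move=> g0 gN p1 sz; have [lm b _ ms] := continuationP g0 gN p1 sz.
apply: linked_segment => //; first by case: lm.
move=> r r01; have bs := well_box_refl sz.
have := potential_jensen g0 p1 b bs r01.
have /andP[r0 r1] := r01.
have : 0 <= r * (1 - r) / 4 * \sum_k (s 0 k - continuation g s 0 k) ^+ 2.
  apply: mulr_ge0; last by apply: sumr_ge0 => k _; exact: sqr_ge0.
  by apply: divr_ge0 => //; apply: mulr_ge0; lra.
have : (1 - r) * potential g (continuation g s) <= (1 - r) * potential g s.
  by rewrite ler_wpM2l //; lra.
by lra.
Qed.

End Continuation.

(** * The saddle reached by moving one site *)

Section Saddle.
Context {R : realType} {M : nat}.
Local Notation N := (2 * M)%N.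
Local Notation m := (M%:R : R).
Implicit Types (g : R) (x s : 'rV[R]_N) (i j k : 'I_N).

Definition saddle_den : R := m ^+ 2 - 3 * m + 3.
Local Notation den := saddle_den.
(** With this normalization the three values taken by [saddle] are the roots of
    one cubic [x ^+ 3 - x = lam]; they are proportional to [M - 1], [-(M - 2)]
    and [-1], as the vanishing of the sum requires. *)
Definition saddle_scale : R := (Num.sqrt den)^-1.
Local Notation t := saddle_scale.

Definition saddle s i : 'rV[R]_N :=
  \row_k (if k == i then - t else if s 0 k == 1 then (m - 1) * t else - (m - 2) * t).

(** Twice the number of neighbours of [i] of the opposite sign: 0 inside a block,
    2 at its edge, 4 at an isolated site. *)
Definition defect s i : R := 2 - s 0 i * (s 0 (ordS i) + s 0 (ord_pred i)).

(** The potential at the saddle of a site with defect [d], in a configuration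
    with [p] interfaces; see [potential_saddle]. *)
Definition saddle_level g (p : nat) (d : R) : R :=
  m * (m - 1) / (4 * den) - m / 2
  + g / (4 * den) * ((2 * m - 3) ^+ 2 * p%:R + 2 * m ^+ 2 - d * (m * (2 * m - 3))).

Hypothesis M4 : (4 <= M)%N.

Lemma m_ge4 : 4 <= m.
Proof. by rewrite (ler_nat R 4 M). Qed.

Lemma den_gt0 : 0 < den.
Proof. by have := m_ge4; rewrite /den; nra. Qed.

Lemma scale_gt0 : 0 < t.
Proof. by rewrite invr_gt0 sqrtr_gt0 den_gt0. Qed.

Lemma scale_sqr : t ^+ 2 = den^-1.
Proof. by rewrite /saddle_scale exprVn sqr_sqrtr // ltW // den_gt0. Qed.

Lemma scale_den : t ^+ 2 * den = 1.
Proof. by rewrite scale_sqr mulVf // lt0r_neq0 // den_gt0. Qed.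

Lemma config_pm1 s : config M s -> pm1 s.
Proof. by case. Qed.

Lemma pm1_neq : (-1 : R) != 1.
Proof. by rewrite eq_sym -subr_eq0 opprK -(natrD R 1 1) pnatr_eq0. Qed.

Lemma sum_config s (u v : R) : config M s ->
  \sum_k (if s 0 k == 1 then u else v) = m * u + m * v.
Proof.
move=> [p1 c1 c2]; rewrite (bigID [pred k | s 0 k == 1]) /=.
congr (_ + _).
  rewrite (eq_bigr (fun=> u)) => [|k /= ->] //.
  by rewrite sumr_const c1 mulr_natl.
rewrite (eq_bigr (fun=> v)) => [|k /= /negPf -> //].
rewrite sumr_const mulr_natl -[in RHS]c2; congr (_ *+ _); apply: eq_card => k.
rewrite -!topredE /=; case: (p1 k) => ->; rewrite !eqxx ?pm1_neq //=.
by rewrite eq_sym (negPf pm1_neq).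
Qed.

Lemma sum_config_upd s i (u v w : R) : config M s -> s 0 i = 1 ->
  \sum_k (if k == i then w else if s 0 k == 1 then u else v)
  = (m - 1) * u + m * v + w.
Proof.
move=> cs si; have := sum_config u v cs.
rewrite (bigD1 i) //= si eqxx => E.
rewrite (bigD1 i) //= eqxx.
rewrite (eq_bigr (fun k => if s 0 k == 1 then u else v)); first by lra.
by move=> k /negPf ->.
Qed.

Lemma config_zero_sum s : config M s -> zero_sum s.
Proof.
move=> cs; rewrite /zero_sum /=.
rewrite (eq_bigr (fun k => if s 0 k == 1 then 1 else -1)).
  by rewrite sum_config //; ring.
move=> k _; case: (config_pm1 cs k) => ->; rewrite ?eqxx //.
by rewrite (negPf pm1_neq).
Qed.

Lemma configN s : config M s -> config M (- s).
Proof.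
move=> [p1 c1 c2]; split.
- by move=> k; rewrite mxE; case: (p1 k) => ->; [right | left; rewrite opprK].
- by rewrite -[RHS]c2; apply: eq_card => k; rewrite !inE mxE eqr_oppLR.
- by rewrite -[RHS]c1; apply: eq_card => k; rewrite !inE mxE eqr_opp.
Qed.

Lemma interfacesN s : interfaces (- s) = interfaces s.
Proof. by apply: eq_card => k; rewrite !inE !mxE eqr_opp. Qed.

Lemma defectN s i : defect (- s) i = defect s i.
Proof. by rewrite /defect !mxE; ring. Qed.

Lemma dirichlet_interfaces s : pm1 s -> dirichlet s = 4 * (interfaces s)%:R.
Proof.
move=> p1; rewrite mulr_natr /interfaces -sumr_const big_mkcond /=.
apply: eq_bigr => k _; rewrite inE.
case: (p1 k) => ->; case: (p1 (ordS k)) => ->; rewrite ?eqxx ?(negPf pm1_neq) /=.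
- by rewrite subrr expr0n.
- by rewrite eq_sym pm1_neq /=; ring.
- by ring.
- by rewrite subrr expr0n.
Qed.

Lemma saddle_zero_sum s i : config M s -> s 0 i = 1 -> zero_sum (saddle s i).
Proof.
move=> cs si; rewrite /zero_sum /=; under eq_bigr do rewrite mxE.
by rewrite sum_config_upd //; ring.
Qed.

Lemma sum_well_saddle s i : config M s -> s 0 i = 1 ->
  \sum_k well (saddle s i 0 k) = m * (m - 1) / (4 * den) - m / 2.
Proof.
move=> cs si.
rewrite (eq_bigr (fun k => if k == i then well (- t) else
    if s 0 k == 1 then well ((m - 1) * t) else well (- (m - 2) * t))); last first.
  by move=> k _; rewrite mxE; case: ifP => // _; case: ifP.
rewrite sum_config_upd //.
have W (c : R) : well (c * t) = c ^+ 4 * (den^-1) ^+ 2 / 4 - c ^+ 2 * den^-1 / 2.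
  by rewrite /well !exprMn -scale_sqr; ring.
rewrite -[- t]mulN1r !W; have d0 := lt0r_neq0 den_gt0.
apply: (mulfI (mulf_neq0 d0 d0)).
transitivity ((m - 1) * ((m - 1) ^+ 4 / 4 - (m - 1) ^+ 2 * den / 2)
  + m * ((- (m - 2)) ^+ 4 / 4 - (- (m - 2)) ^+ 2 * den / 2)
  + ((-1) ^+ 4 / 4 - (-1) ^+ 2 * den / 2)); first by field.
transitivity (den * (m * (m - 1)) / 4 - den ^+ 2 * m / 2); last by field.
by rewrite /den; field.
Qed.

(** The saddle is an affine image of the configuration with the value at [i]
    replaced by [- 3 / (2 * m - 3)], and the gradient term ignores translations. *)
Lemma dirichlet_saddle s i : config M s -> s 0 i = 1 ->
  dirichlet (saddle s i)
  = ((2 * m - 3) ^+ 2 * (interfaces s)%:R + 2 * m ^+ 2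
     - defect s i * (m * (2 * m - 3))) / den.
Proof.
move=> cs si; have p1 := config_pm1 cs; have m4 := m_ge4.
have n0 : 2 * m - 3 != 0 by rewrite lt0r_neq0 //; lra.
pose al := (2 * m - 3) * t / 2.
have -> : dirichlet (saddle s i) = al ^+ 2 * dirichlet (upd s i (- 3 / (2 * m - 3))).
  rewrite /dirichlet mulr_sumr; apply: eq_bigr => k _.
  have E j : saddle s i 0 j = al * upd s i (- 3 / (2 * m - 3)) 0 j + t / 2.
    rewrite mxE updE; case: ifP => _; first by rewrite /al; field.
    by case: (p1 j) => ->; rewrite ?eqxx ?(negPf pm1_neq) /al; field.
  by rewrite !E; ring.
rewrite dirichlet_upd; last by lia.
rewrite dirichlet_interfaces // si.
have -> : lap s i = defect s i by rewrite /lap /defect si; ring.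
rewrite /al !exprMn scale_sqr.
by have d0 := lt0r_neq0 den_gt0; field; rewrite d0 n0.
Qed.

Lemma potential_saddle g s i : config M s -> s 0 i = 1 ->
  potential g (saddle s i) = saddle_level g (interfaces s) (defect s i).
Proof.
move=> cs si; rewrite potentialE sum_well_saddle // dirichlet_saddle //.
by rewrite /saddle_level; have d0 := lt0r_neq0 den_gt0; field.
Qed.

Let slope (c : R) : (c * t) ^+ 3 - c * t = (c ^+ 3 - c * den) * t ^+ 3.
Proof. by rewrite -[X in _ - X]mulr1 -scale_den; ring. Qed.

Lemma saddle_critical s i k :
  saddle s i 0 k ^+ 3 - saddle s i 0 k = (m - 1) * (m - 2) * t ^+ 3.
Proof.
rewrite mxE -[- t]mulN1r; case: ifP => _; last case: ifP => _.
all: by rewrite slope /den; ring.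
Qed.

Lemma scale_mul_le2 (c : R) : `|c| <= m - 1 -> `|c * t| <= 2.
Proof.
have m4 := m_ge4; have t0 := scale_gt0; have te := scale_den.
move=> cm; rewrite normrM (gtr0_norm t0).
apply: (@le_trans _ _ ((m - 1) * t)); first by rewrite ler_wpM2r // ltW.
rewrite -(ler_pXn2r (n := 2)) ?nnegrE //; last by apply: mulr_ge0; lra.
rewrite exprMn; have -> : (2 : R) ^+ 2 = 4 * (t ^+ 2 * den) by rewrite te; ring.
have t2 : 0 < t ^+ 2 by rewrite exprn_gt0.
have : 0 <= t ^+ 2 * (4 * den - (m - 1) ^+ 2).
  apply: mulr_ge0; first exact: ltW.
  by have := sqr_ge0 (m - 4); rewrite /den; lra.
by lra.
Qed.

Lemma saddle_le2 s i k : `|saddle s i 0 k| <= 2.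
Proof.
have m4 := m_ge4; rewrite mxE -[- t]mulN1r; case: ifP => _; last case: ifP => _.
all: by apply: scale_mul_le2; rewrite ler_norml; lra.
Qed.

End Saddle.

Arguments saddle_den {R} M.
Arguments saddle_scale {R} M.
Arguments saddle_level {R} M g p d.

(** * Lower bounds on the boundary of a well *)

Section Faces.
Context {R : realType} {M : nat}.
Local Notation N := (2 * M)%N.
Local Notation m := (M%:R : R).
Local Notation den := (@saddle_den R M).
Local Notation t := (@saddle_scale R M).
Implicit Types (g v : R) (x s : 'rV[R]_N) (i j k : 'I_N).
Hypothesis M4 : (4 <= M)%N.

(** On the face of the well where site [i] has reached [- t], the saddle is the
    unique minimum, with quadratic growth. The remaining particles lie above
    [- t] and, since particles stay above holes in the well, all holes lie
    below [- t]; on these ranges the remainder in [sum_well_tangent] has the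
    right sign. *)
Lemma saddle_face s i x : config M s -> s 0 i = 1 -> zero_sum x -> x 0 i = - t ->
  (forall k, s 0 k = 1 -> - t <= x 0 k) -> (forall k, s 0 k = -1 -> x 0 k <= - t) ->
  \sum_k well (saddle s i 0 k) + 3 / 4 * t ^+ 2 * \sum_k (x 0 k - saddle s i 0 k) ^+ 2
  <= \sum_k well (x 0 k).
Proof.
move=> cs si xz xi xp xm; have m4 := m_ge4 (R := R) M4.
have t0 := scale_gt0 (R := R) M4; have te := scale_den (R := R) M4.
rewrite addrC -lerBrDr (sum_well_tangent xz (saddle_zero_sum cs si)
  (saddle_critical M4 s i)) mulr_sumr.
apply: ler_sum => k _; rewrite [saddle s i 0 k]mxE.
rewrite -subr_ge0; set w := (if _ then _ else _).
rewrite (_ : _ - _ = (x 0 k - w) ^+ 2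
  * ((x 0 k ^+ 2 + 2 * w * x 0 k + 3 * w ^+ 2 - 2) / 4 - 3 / 4 * t ^+ 2)); last by field.
rewrite {}/w; case: eqVneq => [->|_].
  by rewrite xi subrr expr0n mul0r.
have t20 : 0 <= t ^+ 2 by exact: sqr_ge0.
apply: mulr_ge0; first exact: sqr_ge0.
case: (config_pm1 cs k) => sk; rewrite sk ?eqxx ?(negPf (pm1_neq (R:=R))).
  have h : 0 <= (x 0 k + t) * (x 0 k - t + 2 * (m - 1) * t).
    have hx := xp k sk; have mt : 0 <= (m - 2) * t by apply: mulr_ge0; lra.
    by apply: mulr_ge0; lra.
  have : 0 <= t ^+ 2 * ((m - 3) * (m + 1)).
    by apply: (mulr_ge0 t20); apply: mulr_ge0; lra.
  have : t ^+ 2 * den = 1 by [].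
  rewrite /saddle_den; lra.
have h : 0 <= (- x 0 k - t) * (- x 0 k + t + 2 * (m - 2) * t).
  have hx := xm k sk; have mt : 0 <= (m - 2) * t by apply: mulr_ge0; lra.
  by apply: mulr_ge0; lra.
have : 0 <= t ^+ 2 * (m * (m - 4)).
  by apply: (mulr_ge0 t20); apply: mulr_ge0; lra.
have : t ^+ 2 * den = 1 by [].
rewrite /saddle_den; lra.
Qed.

(** The gradient term is convex, and its slope at the saddle times [g] is
    absorbed by the quadratic growth of the wells. *)
Lemma saddle_face_potential g s i x : 0 <= g ->
  config M s -> s 0 i = 1 -> zero_sum x -> x 0 i = - t ->
  (forall k, s 0 k = 1 -> - t <= x 0 k) -> (forall k, s 0 k = -1 -> x 0 k <= - t) ->
  saddle_level M g (interfaces s) (defect s i) - 12 * m * den * g ^+ 2 <= potential g x.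
Proof.
move=> g0 cs si xz xi xp xm; have m4 := m_ge4 (R := R) M4.
have := saddle_face cs si xz xi xp xm.
rewrite -(potential_saddle M4 g cs si) !potentialE.
set w := saddle s i.
have -> : dirichlet x = dirichlet (w + (x - w)) by rewrite subrKC.
rewrite dirichletD; set d := x - w => W.
have D0 := dirichlet_ge0 d.
have gD : 0 <= g / 4 * dirichlet d by rewrite mulr_ge0 //; lra.
have d0 := den_gt0 (R := R) M4.
have : - (12 * m * den * g ^+ 2) <=
   3 / 4 * t ^+ 2 * (\sum_k (x 0 k - w 0 k) ^+ 2) + g / 4 * (2 * \sum_k lap w k * d 0 k).
  rewrite !mulr_sumr -big_split /=.
  have -> : - (12 * m * den * g ^+ 2) = \sum_(k < N) (- (6 * den * g ^+ 2)).
    by rewrite sumr_const card_ord -[RHS]mulr_natr natrM; ring.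
  apply: ler_sum => k _; rewrite (_ : x 0 k - w 0 k = d 0 k); last by rewrite !mxE.
  have l8 : lap w k ^+ 2 <= 64.
    have := saddle_le2 M4 s i k; have := saddle_le2 M4 s i (ordS k).
    have := saddle_le2 M4 s i (ord_pred k).
    rewrite -/w !ler_norml => /andP[a1 a2] /andP[b1 b2] /andP[c1 c2].
    have : `|lap w k| <= 8 by rewrite /lap ler_norml; lra.
    by rewrite ler_norml; nra.
  have sq := sqr_ge0 (3 * d 0 k + den * g * lap w k).
  have td := scale_den (R := R) M4.
  have : den * g ^+ 2 * lap w k ^+ 2 <= den * g ^+ 2 * 64.
    by rewrite ler_wpM2l // mulr_ge0 ?sqr_ge0 // ltW.
  have : 0 <= t ^+ 2 * (3 * d 0 k + den * g * lap w k) ^+ 2.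
    by rewrite mulr_ge0 ?sqr_ge0.
  have -> : t ^+ 2 * (3 * d 0 k + den * g * lap w k) ^+ 2
     = 9 * t ^+ 2 * d 0 k ^+ 2 + 6 * g * lap w k * d 0 k * (t ^+ 2 * den)
      + (t ^+ 2 * den) * den * g ^+ 2 * lap w k ^+ 2 by ring.
  have dg : 0 <= den * g ^+ 2 by rewrite mulr_ge0 ?sqr_ge0 // ltW.
  by rewrite td; lra.
by lra.
Qed.

Lemma well_ge_quarter v : - (1 / 4) <= well v.
Proof. by have := sqr_ge0 (v ^+ 2 - 1); rewrite /well; lra. Qed.

Lemma sum_well_pair x i j v : i != j -> x 0 i = v -> x 0 j = v ->
  (1 - v ^+ 2) ^+ 2 / 2 - m / 2 <= \sum_k well (x 0 k).
Proof.
move=> ij xi xj.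
have : 0 <= \sum_(k | (k != i) && (k != j)) (well (x 0 k) + 1 / 4).
  by apply: sumr_ge0 => k _; have := well_ge_quarter (x 0 k); lra.
have : \sum_k (well (x 0 k) + 1 / 4) = \sum_k well (x 0 k) + m / 2.
  by rewrite big_split /= sumr_const card_ord -[X in _ + X]mulr_natr natrM; lra.
rewrite (bigD1 i) //= (bigD1 j) 1?eq_sym //= xi xj /well; lra.
Qed.

(** For eight sites, two sites at the value [v] alone do not cost enough when [v]
    is close to [- t]. There the collision is compared with the saddle itself. *)
Let collision4 s i j x v : (M = 4)%N -> config M s -> s 0 i = 1 -> s 0 j = -1 ->
  zero_sum x -> x 0 i = v -> x 0 j = v -> - t <= v <= 0 ->
  (forall k, s 0 k = 1 -> v <= x 0 k) -> (forall k, s 0 k = -1 -> x 0 k <= v) ->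
  m * (m - 1) / (4 * den) - m / 2 + (1000 * den ^+ 2)^-1 <= \sum_k well (x 0 k).
Proof.
move=> M_4 cs si sj xz xi xj /andP[vt v0] xp xm.
have ij : i != j.
  by apply/eqP => E; move: sj; rewrite -E si => /eqP; rewrite eq_sym (negPf (pm1_neq (R := R))).
have mE : m = 4 by rewrite M_4.
have dE : den = 7 by rewrite /saddle_den mE; lra.
have te := scale_den (R := R) M4; rewrite dE in te.
have t0 := scale_gt0 (R := R) M4.
rewrite dE mE.
(* Below 7/10 of the way to [- t], two sites at [v] cost more than the saddle
   by themselves; beyond, the formula around the saddle is positive. *)
have [v7|v7] := leP v (- (7 / 10 * t)); last first.
  have := sum_well_pair ij xi xj; rewrite mE.
  have : v ^+ 2 <= 7 / 100 by nra.
  set q := v ^+ 2 => q7.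
  have : (93 / 100) ^+ 2 <= (1 - q) ^+ 2 by nra.
  by lra.
pose F k : R := (x 0 k - saddle s i 0 k) ^+ 2 * (x 0 k ^+ 2
  + 2 * saddle s i 0 k * x 0 k + 3 * saddle s i 0 k ^+ 2 - 2) / 4.
have : _ = \sum_k F k :=
  sum_well_tangent xz (saddle_zero_sum cs si) (saddle_critical M4 s i).
rewrite (sum_well_saddle M4 cs si) dE mE => E.
suff : (1000 * 7 ^+ 2)^-1 <= \sum_k F k by rewrite -E; lra.
rewrite (bigD1 i) //= (bigD1 j) 1?eq_sym //=.
have rest : 0 <= \sum_(k | (k != i) && (k != j)) F k.
  apply: sumr_ge0 => k /andP[/negPf ki _]; rewrite /F !mxE ki.
  rewrite -mulrA; apply: mulr_ge0; first exact: sqr_ge0.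
  case: (config_pm1 cs k) => sk; rewrite sk ?eqxx ?(negPf (pm1_neq (R:=R))) mE.
    by have := xp k sk; nra.
  by have := xm k sk; nra.
have [y yE] : exists y, v = - (y * t).
  by exists (- v / t); field; rewrite lt0r_neq0.
have y1 : 7 / 10 <= y <= 1 by apply/andP; split; nra.
have Fi : F i = t ^+ 4 * ((1 - y) ^+ 2 * (y ^+ 2 + 2 * y - 11)) / 4.
  transitivity (t ^+ 4 * ((1 - y) ^+ 2 * (y ^+ 2 + 2 * y - 11)) / 4
      + (1 - y) ^+ 2 * t ^+ 2 / 2 * (t ^+ 2 * 7 - 1)).
    by rewrite /F !mxE eqxx xi yE; field.
  by rewrite te subrr mulr0 addr0.
have Fj : F j = t ^+ 4 * ((2 - y) ^+ 2 * (y ^+ 2 + 4 * y - 2)) / 4.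
  transitivity (t ^+ 4 * ((2 - y) ^+ 2 * (y ^+ 2 + 4 * y - 2)) / 4
      + (2 - y) ^+ 2 * t ^+ 2 / 2 * (t ^+ 2 * 7 - 1)).
    by rewrite /F !mxE eq_sym (negPf ij) sj (negPf (pm1_neq (R := R))) mE xj yE; field.
  by rewrite te subrr mulr0 addr0.
have t4 : t ^+ 4 = 1 / 49.
  have -> : t ^+ 4 = (t ^+ 2) ^+ 2 by rewrite -exprM.
  have -> : t ^+ 2 = 1 / 7 by lra.
  by field.
rewrite Fi Fj t4.
pose z := 1 - y; have yz : y = 1 - z by rewrite /z; ring.
have [z0 z1] : 0 <= z /\ z <= 3 / 10 by split; rewrite /z; lra.
have z2 : z ^+ 2 <= 9 / 100 by nra.
have z3 : z ^+ 3 <= 27 / 1000.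
  by rewrite exprS; have := sqr_ge0 z; nra.
have z4 := sqr_ge0 (z ^+ 2).
rewrite yz; lra.
Qed.

(** A particle and a hole meeting at a common value [v] cost strictly more than
    the saddle already at zero coupling: both sit near the top of the well. *)
Lemma collision s i j x v : config M s -> s 0 i = 1 -> s 0 j = -1 ->
  zero_sum x -> x 0 i = v -> x 0 j = v -> - t <= v <= t ->
  (forall k, s 0 k = 1 -> v <= x 0 k) -> (forall k, s 0 k = -1 -> x 0 k <= v) ->
  m * (m - 1) / (4 * den) - m / 2 + (1000 * den ^+ 2)^-1 <= \sum_k well (x 0 k).
Proof.
move=> cs si sj xz xi xj /andP[vt tv] xp xm.
have ij : i != j.
  by apply/eqP => E; move: sj; rewrite -E si => /eqP; rewrite eq_sym (negPf (pm1_neq (R := R))).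
have [M_4|M5] : (M = 4)%N \/ (5 <= M)%N by lia.
  have [v0|v0] := leP v 0.
    by apply: (collision4 M_4 cs si sj xz xi xj) => //; rewrite vt.
  have nz := zero_sumN xz; have cn := configN cs.
  have -> : \sum_k well (x 0 k) = \sum_k well ((- x) 0 k).
    by apply: eq_bigr => k _; rewrite mxE /well; ring.
  apply: (collision4 (s := - s) (i := j) (j := i) (v := - v) M_4 cn) => //.
  - by rewrite mxE sj opprK.
  - by rewrite mxE si.
  - by rewrite mxE xj.
  - by rewrite mxE xi.
  - by apply/andP; split; lra.
  - by move=> k; rewrite !mxE => sk; rewrite lerN2; apply: xm; rewrite -sk opprK.
  - by move=> k; rewrite !mxE => /oppr_inj sk; rewrite lerN2; exact: xp.
have := sum_well_pair ij xi xj.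
have t0 := scale_gt0 (R := R) M4; have te := scale_sqr (R := R) M4.
have d0 := den_gt0 (R := R) M4; have m4 := m_ge4 (R := R) M4.
have m5 : 5 <= m by rewrite (ler_nat R 5 M).
have v2 : v ^+ 2 <= den^-1.
  have : 0 <= (t - v) * (t + v) by apply: mulr_ge0; lra.
  by rewrite -te; lra.
have d1 : den^-1 <= 1.
  have := sqr_ge0 (m - 4).
  by rewrite invf_le1 // /saddle_den; lra.
have : (1 - den^-1) ^+ 2 <= (1 - v ^+ 2) ^+ 2.
  by rewrite ler_pXn2r // ?nnegrE; lra.
suff : m * (m - 1) / (4 * den) + (1000 * den ^+ 2)^-1 <= (1 - den^-1) ^+ 2 / 2 by lra.
rewrite -subr_ge0.
have -> : (1 - den^-1) ^+ 2 / 2 - (m * (m - 1) / (4 * den) + (1000 * den ^+ 2)^-1)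
   = (2 * (den - 1) ^+ 2 - m * (m - 1) * den - 4 / 1000) / (4 * den ^+ 2).
  by field; rewrite lt0r_neq0.
apply: divr_ge0; last by rewrite mulr_ge0 ?sqr_ge0.
have -> : 2 * (den - 1) ^+ 2 - m * (m - 1) * den
   = (m - 1) * (m ^+ 3 - 7 * m ^+ 2 + 13 * m - 8) by rewrite /saddle_den; ring.
have : 7 <= m ^+ 3 - 7 * m ^+ 2 + 13 * m - 8.
  pose z := m - 5; have -> : m = z + 5 by rewrite /z; ring.
  have z0 : 0 <= z by rewrite /z; lra.
  have : 0 <= z ^+ 2 by exact: sqr_ge0.
  have : 0 <= z ^+ 3 by rewrite exprn_ge0.
  by lra.
by nra.
Qed.

End Faces.

(** * Leaving the well of a configuration *)

Section Exit.
Context {R : realType} {M : nat}.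
Local Notation N := (2 * M)%N.
Local Notation m := (M%:R : R).
Local Notation den := (@saddle_den R M).
Local Notation t := (@saddle_scale R M).
Implicit Types (g v : R) (x s : 'rV[R]_N) (i j k : 'I_N).
Hypothesis M4 : (4 <= M)%N.

Lemma config_has (v : R) s : v = 1 \/ v = -1 -> config M s -> exists i, s 0 i = v.
Proof.
move=> hv [_ c1 c2]; have : (0 < #|[pred i : 'I_N | s ord0 i == v]|)%N.
  by case: hv => ->; rewrite ?c1 ?c2; lia.
by move=> /card_gt0P[i]; rewrite inE => /eqP si; exists i.
Qed.

Lemma scale_lt : t < 7 / 8.
Proof.
have t0 := scale_gt0 (R := R) M4; have te := scale_den (R := R) M4.
have m4 := m_ge4 (R := R) M4.
have d7 : 7 <= den by have := sqr_ge0 (m - 4); rewrite /saddle_den; lra.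
have : t ^+ 2 * 7 <= t ^+ 2 * den by rewrite ler_wpM2l ?sqr_ge0.
by rewrite te; nra.
Qed.

Lemma saddle_level_le g p (d d' : R) : 0 <= g -> d <= d' ->
  saddle_level M g p d' <= saddle_level M g p d.
Proof.
move=> g0 dd; rewrite /saddle_level lerD2l.
have m4 := m_ge4 (R := R) M4; have d0 := den_gt0 (R := R) M4.
apply: ler_wpM2l; first by rewrite divr_ge0 // mulr_ge0 // ltW.
have : d * (m * (2 * m - 3)) <= d' * (m * (2 * m - 3)).
  by apply: ler_wpM2r => //; apply: mulr_ge0; lra.
by lra.
Qed.

(** The first-order part of every saddle level fits in the excess energy of a
    collision. *)
Definition weak_coupling g :=
  g / (4 * den) * ((2 * m - 3) ^+ 2 * (2 * m) + 2 * m ^+ 2) <= (1000 * den ^+ 2)^-1.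

(** A path to another minimum leaves the region where particles are above [- t],
    holes are below [t], and every particle is above every hole. On the boundary
    one of [saddle_face_potential], its mirror image for a hole, or [collision]
    applies. *)
Lemma exit_level g s s' (d : R) (G : R -> 'rV[R]_N) :
  0 <= g -> weak_coupling g -> config M s -> config M s' -> s <> s' ->
  0 <= d -> (forall i, defect s i <= d) ->
  {within `[0, 1], continuous G} -> (forall r, 0 <= r <= 1 -> zero_sum (G r)) ->
  (forall k, `|G 0 0 k - s 0 k| < 1 / 8) -> (forall k, `|G 1 0 k - s' 0 k| < 1 / 8) ->
  exists2 r, 0 <= r <= 1 &
    saddle_level M g (interfaces s) d - 12 * m * den * g ^+ 2 <= potential g (G r).
Proof.
move=> g0 gw cs cs' ss' d0 sd cG zG G0 G1.
have t0 := scale_gt0 (R := R) M4; have t78 := scale_lt.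
have m4 := m_ge4 (R := R) M4; have den0 := den_gt0 (R := R) M4.
(* The constraints defining the region, for a particle and a hole; the
   constant 1 is a harmless filler for the other pairs. *)
pose f (q : 'I_N * 'I_N) r : R := if (s 0 q.1 == 1) && (s 0 q.2 == -1) then
   Num.min (Num.min (G r 0 q.1 + t) (t - G r 0 q.2)) (G r 0 q.1 - G r 0 q.2) else 1.
have cf q : {within `[0, 1], continuous (f q)}.
  rewrite /f; case: (_ && _); last by move=> r; exact: cvg_cst.
  have cj j : {within `[0, 1], continuous (fun r => G r 0 j)}.
    move=> r; apply: (@continuous_comp (subspace [set` `[0 : R, 1]]) 'rV[R]_N R G
      (fun x => x 0 j) r (cG r)).
    exact: coord_continuous.
  have cA : {within `[0, 1], continuous (fun r => G r 0 q.1 + t)}.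
    by move=> r; apply: cvgD; [exact: cj | exact: cvg_cst].
  have cB : {within `[0, 1], continuous (fun r => t - G r 0 q.2)}.
    by move=> r; apply: cvgB; [exact: cvg_cst | exact: cj].
  have cC : {within `[0, 1], continuous (fun r => G r 0 q.1 - G r 0 q.2)}.
    by move=> r; apply: cvgB; exact: cj.
  by move=> r; have := continuous_min (continuous_min (cA r) (cB r)) (cC r).
have f0 q : 0 < f q 0.
  rewrite /f; case: ifP => // /andP[/eqP q1 /eqP q2].
  have := G0 q.1; have := G0 q.2; rewrite q1 q2 !ltr_norml !lt_min; lra.
have [q fq] : exists q, f q 1 <= 0.
  have [k sk] : exists k, s 0 k <> s' 0 k.
    apply: contrapT => nk; apply: ss'; apply/rowP => k.
    by apply: contrapT => sk; apply: nk; exists k.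
  have := G1 k; case: (config_pm1 cs k) (config_pm1 cs' k) sk => sk [s'k|s'k];
    rewrite sk s'k // => _ G1k.
  - have [j sj] := config_has (or_intror erefl) cs; exists (k, j).
    rewrite /f /= sk sj !eqxx /= !ge_min; move: G1k; rewrite ltr_norml; lra.
  - have [i si] := config_has (or_introl erefl) cs; exists (i, k).
    rewrite /f /= sk si !eqxx /= !ge_min; move: G1k; rewrite ltr_norml; lra.
have [r r01 [fr [[i j] fij]]] := first_exit ler01 cf f0 fq.
exists r => //; set x := G r.
move: fij; rewrite /f /=; case: ifP => [/andP[/eqP si /eqP sj]|_ /eqP]; last first.
  by rewrite oner_eq0.
rewrite -/x => fij.
have P k l : s 0 k = 1 -> s 0 l = -1 ->
    [/\ - t <= x 0 k, x 0 l <= t & x 0 l <= x 0 k].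
  move=> sk sl; have := fr (k, l); rewrite /f /= sk sl !eqxx /= !le_min -/x.
  by case/andP => /andP[a1 a2] a3; split; lra.
have xz : zero_sum x := zG r r01.
have Pk k : s 0 k = 1 -> - t <= x 0 k /\ x 0 j <= x 0 k by move=> /P /(_ sj)[].
have Pl l : s 0 l = -1 -> x 0 l <= t /\ x 0 l <= x 0 i by move=> /(P _ _ si)[].
have lvl k : saddle_level M g (interfaces s) d <= saddle_level M g (interfaces s) (defect s k).
  by apply: saddle_level_le.
have : [\/ x 0 i + t = 0, t - x 0 j = 0 | x 0 i - x 0 j = 0].
  by move: fij; rewrite !minEle; case: ifP => _; [case: ifP => _ |] => ?;
     [constructor 1 | constructor 2 | constructor 3].
case=> /eqP; rewrite ?subr_eq0 ?addr_eq0 => /eqP E.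
- have xp k : s 0 k = 1 -> - t <= x 0 k by move=> /Pk[].
  have xm k : s 0 k = -1 -> x 0 k <= - t by rewrite -E => /Pl[].
  have := saddle_face_potential M4 g0 cs si xz E xp xm.
  by have := lvl i; lra.
- rewrite -potentialN -(interfacesN s).
  have sj' : (- s) 0 j = 1 by rewrite mxE sj opprK.
  have xj' : (- x) 0 j = - t by rewrite mxE E.
  have xp k : (- s) 0 k = 1 -> - t <= (- x) 0 k.
    by rewrite !mxE lerN2 => h; have [] := Pl k _; first by rewrite -h opprK.
  have xm k : (- s) 0 k = -1 -> (- x) 0 k <= - t.
    by rewrite !mxE lerN2 E => /oppr_inj /Pk[].
  have := saddle_face_potential M4 g0 (configN cs) sj' (zero_sumN xz) xj' xp xm.
  by rewrite interfacesN defectN; have := lvl j; lra.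
- have [ti tj _] := P i j si sj.
  have vt : - t <= x 0 i <= t by rewrite ti E.
  have xp k : s 0 k = 1 -> x 0 i <= x 0 k by rewrite E => /Pk[].
  have xm k : s 0 k = -1 -> x 0 k <= x 0 i by move=> /Pl[].
  have := collision M4 cs si sj xz erefl (esym E) vt xp xm.
  rewrite potentialE => W.
  have D : 0 <= g / 4 * dirichlet x by rewrite mulr_ge0 ?dirichlet_ge0 //; lra.
  have : saddle_level M g (interfaces s) d
     <= m * (m - 1) / (4 * den) - m / 2 + (1000 * den ^+ 2)^-1.
    apply: le_trans (_ : _ <= saddle_level M g (interfaces s) 0) _.
      exact: saddle_level_le.
    rewrite /saddle_level lerD2l; apply: le_trans gw.
    apply: ler_wpM2l; first by rewrite divr_ge0 // mulr_ge0 // ltW.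
    rewrite mul0r subr0 lerD2r; apply: ler_wpM2l; first exact: sqr_ge0.
    by rewrite -natrM ler_nat -[leqRHS]card_ord max_card.
  have : 0 <= 12 * m * den * g ^+ 2.
    by apply: mulr_ge0; [apply: mulr_ge0; lra | exact: sqr_ge0].
  by lra.
Qed.

End Exit.

(** * Segments through a saddle *)

Section SaddleSegment.
Context {R : realType} {N : nat}.
Implicit Types (g c r : R) (w x y : 'rV[R]_N).

(** Along a segment issued from a critical point, the energy difference is
    [r ^+ 2] times a convex quadratic in [r], so two values control it: the
    Hessian along the segment, at [r = 0], and the end point, at [r = 1]. *)
Lemma sum_well_saddle_segment (lam : R) w y c r :
  zero_sum w -> zero_sum y -> (forall k, w 0 k ^+ 3 - w 0 k = lam) ->
  \sum_k (y 0 k - w 0 k) ^+ 2 * (6 * w 0 k ^+ 2 - 2) <= - (4 * c) ->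
  \sum_k well (y 0 k) - \sum_k well (w 0 k) <= - c -> 0 <= r <= 1 ->
  \sum_k well ((w + r *: (y - w)) 0 k) - \sum_k well (w 0 k) <= - (c * r ^+ 2).
Proof.
move=> wz yz wl Q Y r01; have /andP[r0 r1] := r01.
move: Y; rewrite (sum_well_tangent yz wz wl).
rewrite (sum_well_tangent (zero_sum_segment r wz yz) wz wl).
set q1 := \sum_k _; set q0 := \sum_k _ in Q *; set q := \sum_k _ => Y.
have : q <= r ^+ 2 * ((1 - r) * (q0 / 4) + r * q1).
  rewrite /q /q0 /q1 mulr_suml !mulr_sumr -big_split mulr_sumr /=.
  apply: ler_sum => k _; rewrite !mxE -subr_ge0.
  set d := y 0 k - w 0 k.
  have -> : y 0 k = w 0 k + d by rewrite /d; ring.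
  set v := w 0 k.
  rewrite (_ : _ - _ = r ^+ 2 * (d ^+ 2) ^+ 2 * (r * (1 - r)) / 4); last by field.
  apply: divr_ge0 => //; apply: mulr_ge0; last by apply: mulr_ge0; lra.
  by apply: mulr_ge0; exact: sqr_ge0.
have : r ^+ 2 * ((1 - r) * (q0 / 4) + r * q1) <= r ^+ 2 * - c.
  apply: ler_wpM2l; first exact: sqr_ge0.
  have : (1 - r) * (q0 / 4) <= (1 - r) * - c by apply: ler_wpM2l; lra.
  have : r * q1 <= r * - c by apply: ler_wpM2l; lra.
  by lra.
by lra.
Qed.

Lemma dirichlet_segment_le w y r :
  (forall k, `|w 0 k| <= 2) -> (forall k, `|y 0 k| <= 2) -> 0 <= r <= 1 ->
  dirichlet (w + r *: (y - w)) <= dirichlet w + 128 * N%:R * r.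
Proof.
move=> w2 y2 /andP[r0 r1].
have -> : 128 * N%:R * r = \sum_(k < N) 128 * r.
  by rewrite sumr_const card_ord -[RHS]mulr_natr; ring.
rewrite /dirichlet -big_split /=; apply: ler_sum => k _; rewrite !mxE.
move: (w2 k) (w2 (ordS k)) (y2 k) (y2 (ordS k)).
set a := w 0 k; set b := w 0 _; set p := y 0 k; set q := y 0 _.
rewrite !ler_norml => /andP[a1 a2] /andP[b1 b2] /andP[p1 p2] /andP[q1 q2].
pose u := b - a; pose v := (q - b) - (p - a).
have -> : b + r * (q - b) - (a + r * (p - a)) = u + r * v by rewrite /u /v; ring.
rewrite -/u.
have [u1 u2] : - 4 <= u /\ u <= 4 by split; rewrite /u; lra.
have [v1 v2] : - 8 <= v /\ v <= 8 by split; rewrite /v; lra.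
have uv : u * v <= 32 by nra.
have vv : v ^+ 2 <= 64 by nra.
have ruv : r * (u * v) <= r * 32 by rewrite ler_wpM2l.
have rvv : r ^+ 2 * v ^+ 2 <= r * 64.
  have : r ^+ 2 * v ^+ 2 <= r ^+ 2 * 64 by rewrite ler_wpM2l ?sqr_ge0.
  by nra.
by nra.
Qed.

(** The gradient term grows at most linearly in [r], with a factor [g]; the
    quadratic decrease of the well energy turns this into an excess of order
    [g ^+ 2]. *)
Lemma linked_saddle_segment (lam : R) w y g c : 0 <= g -> 0 < c ->
  zero_sum w -> zero_sum y -> (forall k, w 0 k ^+ 3 - w 0 k = lam) ->
  (forall k, `|w 0 k| <= 2) -> (forall k, `|y 0 k| <= 2) ->
  \sum_k (y 0 k - w 0 k) ^+ 2 * (6 * w 0 k ^+ 2 - 2) <= - (4 * c) ->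
  \sum_k well (y 0 k) - \sum_k well (w 0 k) <= - c ->
  linked g (potential g w + 256 * N%:R ^+ 2 / c * g ^+ 2) w y.
Proof.
move=> g0 c0 wz yz wl w2 y2 Q Y; apply: linked_segment => // r r01.
have /andP[r0 r1] := r01; rewrite !potentialE.
have W := sum_well_saddle_segment wz yz wl Q Y r01.
have D := dirichlet_segment_le w2 y2 r01.
have : g / 4 * dirichlet (w + r *: (y - w)) <= g / 4 * (dirichlet w + 128 * N%:R * r).
  by apply: ler_wpM2l => //; lra.
have : 0 <= (16 * g * N%:R - c * r) ^+ 2 / c by rewrite divr_ge0 ?sqr_ge0 // ltW.
have -> : (16 * g * N%:R - c * r) ^+ 2 / c
   = 256 * N%:R ^+ 2 / c * g ^+ 2 - 32 * g * N%:R * r + c * r ^+ 2.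
  by field; rewrite lt0r_neq0.
by lra.
Qed.

End SaddleSegment.

Section HalfStep.
Context {R : realType} {M : nat}.
Local Notation N := (2 * M)%N.
Local Notation m := (M%:R : R).
Local Notation den := (@saddle_den R M).
Local Notation t := (@saddle_scale R M).
Implicit Types (g c : R) (x s : 'rV[R]_N) (i j k : 'I_N).
Hypothesis M4 : (4 <= M)%N.

(** A point of low energy with the sign pattern of [s] flipped at [i]. It gives
    [i] the same value as the holes, so that it depends on that pattern only and
    is shared by all configurations obtained by flipping a hole next. *)
Definition relay s i : 'rV[R]_N :=
  \row_k (if k == i then - ((m - 1) ^+ 2 / (m + 1)) * t else
          if s 0 k == 1 then (m - 1) * t else - ((m - 1) ^+ 2 / (m + 1)) * t).

Let mp1 : m + 1 != 0.
Proof. by have := m_ge4 (R := R) M4; rewrite lt0r_neq0 //; lra. Qed.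

Lemma relay_zero_sum s i : config M s -> s 0 i = 1 -> zero_sum (relay s i).
Proof.
move=> cs si; rewrite /zero_sum /=; under eq_bigr do rewrite mxE.
by rewrite sum_config_upd //; field.
Qed.

Lemma relay_le2 s i k : `|relay s i 0 k| <= 2.
Proof.
have m4 := m_ge4 (R := R) M4.
have e1 : 0 <= (m - 1) ^+ 2 / (m + 1) by rewrite divr_ge0 ?sqr_ge0 //; lra.
have e2 : (m - 1) ^+ 2 / (m + 1) <= m - 1.
  by rewrite ler_pdivrMr; [nra | lra].
rewrite mxE; case: ifP => _; last case: ifP => _.
all: by apply: scale_mul_le2 => //; rewrite ler_norml; lra.
Qed.

Lemma config_le2 s k : config M s -> `|s 0 k| <= 2.
Proof. by move=> /config_pm1 /(_ k)[->|->]; rewrite ?normrN normr1; lra. Qed.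

Lemma saddle_to_relay g s i : 0 <= g -> config M s -> s 0 i = 1 ->
  linked g (saddle_level M g (interfaces s) (defect s i)
    + 256 * N%:R ^+ 2 / (m * (m - 3) ^+ 2 / (4 * (m + 1) ^+ 2 * den ^+ 2)) * g ^+ 2)
    (saddle s i) (relay s i).
Proof.
move=> g0 cs si; rewrite -potential_saddle //.
have m4 := m_ge4 (R := R) M4; have d0 := den_gt0 (R := R) M4.
have te := scale_sqr (R := R) M4.
have [mu muD] : exists mu : R, mu = (m - 3) / (m + 1) by eexists.
have [ka kaD] : exists ka : R, ka = (m - 1) ^+ 2 / (m + 1) by eexists.
set c := m * _ / _.
have cE : c = mu ^+ 2 * m * den^-1 ^+ 2 / 4.
  by rewrite /c muD; field; rewrite mp1 lt0r_neq0.
have c0 : 0 < c.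
  rewrite /c divr_gt0 ?mulr_gt0 ?exprn_gt0 //; lra.
have S (F : R -> R -> R) : \sum_k F (relay s i 0 k) (saddle s i 0 k)
   = (m - 1) * F ((m - 1) * t) ((m - 1) * t) + m * F (- ka * t) (- (m - 2) * t)
     + F (- ka * t) (- t).
  rewrite -(sum_config_upd _ _ _ cs si); apply: eq_bigr => k _; rewrite !mxE -kaD.
  by case: ifP => // _; case: ifP.
have muE : - ka + (m - 2) = mu by rewrite kaD muD; field.
have mumE : - ka + 1 = - (m * mu) by rewrite kaD muD; field.
have e1 : den * den^-1 = 1 by rewrite mulfV // lt0r_neq0.
have muge0 : 0 <= mu ^+ 2 * m * den^-1 ^+ 2.
  by apply: mulr_ge0; [apply: mulr_ge0; [exact: sqr_ge0 | lra] | exact: sqr_ge0].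
have z0 : 0 <= m - 4 by lra.
have z2 : 0 <= (m - 4) ^+ 2 by rewrite exprn_ge0.
have z3 : 0 <= (m - 4) ^+ 3 by rewrite exprn_ge0.
have z4 : 0 <= (m - 4) ^+ 4 by rewrite exprn_ge0.
apply: (@linked_saddle_segment _ _ ((m - 1) * (m - 2) * t ^+ 3)) => //.
- exact: saddle_zero_sum.
- exact: relay_zero_sum.
- exact: saddle_critical.
- exact: saddle_le2.
- exact: relay_le2.
- rewrite (S (fun y w => (y - w) ^+ 2 * (6 * w ^+ 2 - 2))) subrr expr0n /= mul0r mulr0 add0r.
  have -> : - ka * t - - (m - 2) * t = mu * t by rewrite -muE; ring.
  have -> : - ka * t - - t = - (m * mu) * t by rewrite -mumE; ring.
  rewrite !exprMn !sqrrN te cE -subr_ge0.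
  rewrite (_ : _ - _ = mu ^+ 2 * m * den^-1 ^+ 2 *
     (2 * (1 + m) * den - 6 * (m - 2) ^+ 2 - 6 * m - 1)
     + 2 * m * mu ^+ 2 * den^-1 * (1 + m) * (1 - den * den^-1)); last by field; rewrite lt0r_neq0.
  rewrite e1 subrr mulr0 addr0.
  apply: mulr_ge0; first exact: muge0.
  by rewrite /saddle_den; lra.
- rewrite (sum_well_tangent (relay_zero_sum cs si) (saddle_zero_sum cs si)
    (saddle_critical M4 s i)).
  rewrite (S (fun y w => (y - w) ^+ 2 * (y ^+ 2 + 2 * w * y + 3 * w ^+ 2 - 2) / 4)).
  rewrite subrr expr0n /= !mul0r mulr0 add0r.
  have -> : - ka * t - - (m - 2) * t = mu * t by rewrite -muE; ring.
  have -> : - ka * t - - t = - (m * mu) * t by rewrite -mumE; ring.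
  rewrite cE -subr_ge0.
  rewrite (_ : _ - _ = mu ^+ 2 * m * t ^+ 2 / 4 *
     (2 * (1 + m) - t ^+ 2 * ((1 + m) * ka ^+ 2 + 4 * (m - 1) * ka + 3 * (m - 2) ^+ 2 + 3 * m))
     - mu ^+ 2 * m * den^-1 ^+ 2 / 4); last by field; rewrite lt0r_neq0.
  rewrite te.
  rewrite (_ : _ - _ = mu ^+ 2 * m * den^-1 ^+ 2 *
    ((2 * (1 + m) * den - ((1 + m) * ka ^+ 2 + 4 * (m - 1) * ka + 3 * (m - 2) ^+ 2 + 3 * m)
     - 1) / 4)
     + mu ^+ 2 * m * den^-1 * (1 + m) / 2 * (1 - den * den^-1)); last by field; rewrite lt0r_neq0.
  rewrite e1 subrr mulr0 addr0.
  apply: mulr_ge0; first exact: muge0.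
  apply: divr_ge0 => //.
  rewrite (_ : _ - 1 = (2 * (1 + m) ^+ 2 * den - (m - 1) ^+ 4 - 4 * (m - 1) ^+ 3
      - (3 * (m - 2) ^+ 2 + 3 * m + 1) * (m + 1)) / (m + 1)); last by rewrite kaD; field.
  apply: divr_ge0; last by lra.
  by rewrite /saddle_den; lra.
Qed.

Lemma saddle_to_config g s i : 0 <= g -> config M s -> s 0 i = 1 ->
  linked g (saddle_level M g (interfaces s) (defect s i)
    + 256 * N%:R ^+ 2 / (1 / 16) * g ^+ 2)
    (saddle s i) s.
Proof.
move=> g0 cs si; rewrite -potential_saddle //.
have m4 := m_ge4 (R := R) M4; have d0 := den_gt0 (R := R) M4.
have t0 := scale_gt0 (R := R) M4.
have te := scale_sqr (R := R) M4; have td := scale_den (R := R) M4.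
have e1 : den * den^-1 = 1 by rewrite mulfV // lt0r_neq0.
have e0 : 0 < den^-1 by rewrite invr_gt0.
have z0 : 0 <= m - 4 by lra.
have z2 : 0 <= (m - 4) ^+ 2 by rewrite exprn_ge0.
have z3 : 0 <= (m - 4) ^+ 3 by rewrite exprn_ge0.
have z4 : 0 <= (m - 4) ^+ 4 by rewrite exprn_ge0.
have z5 : 0 <= (m - 4) ^+ 5 by rewrite exprn_ge0.
have z6 : 0 <= (m - 4) ^+ 6 by rewrite exprn_ge0.
have d7 : 7 <= den by rewrite /saddle_den; lra.
apply: (@linked_saddle_segment _ _ ((m - 1) * (m - 2) * t ^+ 3)) => //.
- exact: saddle_zero_sum.
- exact: config_zero_sum.
- exact: saddle_critical.
- exact: saddle_le2.
- by move=> k; exact: config_le2.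
- have -> : \sum_k (s 0 k - saddle s i 0 k) ^+ 2 * (6 * saddle s i 0 k ^+ 2 - 2)
    = (m - 1) * ((1 - (m - 1) * t) ^+ 2 * (6 * ((m - 1) * t) ^+ 2 - 2))
    + m * ((- 1 - - (m - 2) * t) ^+ 2 * (6 * (- (m - 2) * t) ^+ 2 - 2))
    + (1 - - t) ^+ 2 * (6 * (- t) ^+ 2 - 2).
    rewrite -(sum_config_upd _ _ _ cs si); apply: eq_bigr => k _; rewrite !mxE.
    case: eqVneq => [->|_]; first by rewrite si.
    by case: (config_pm1 cs k) => ->; rewrite ?eqxx ?(negPf (pm1_neq (R := R))).
  set e := den^-1 in e0 e1 te *.
  pose a := (m - 1) * t; pose u := (m - 2) * t.
  have a0 : 0 <= a by apply: mulr_ge0; lra.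
  have u0 : 0 <= u by apply: mulr_ge0; lra.
  have a2 : a ^+ 2 = 1 + (m - 2) * e.
    have := e1; rewrite /a exprMn te /saddle_den; lra.
  have u2 : u ^+ 2 = 1 - (m - 1) * e.
    have := e1; rewrite /u exprMn te /saddle_den; lra.
  have a1 : 1 <= a by nra.
  have me : (m - 1) * e <= 3 / 7.
    rewrite /e ler_pdivrMr // /saddle_den; lra.
  (* The distances [a - 1] and [1 - u] are read off [a ^+ 2] and [u ^+ 2]. *)
  have u1 : 1 / 2 <= u by nra.
  have A : (1 - a) ^+ 2 <= (m - 2) ^+ 2 * e ^+ 2 / 4.
    have : (a - 1) ^+ 2 * (a + 1) ^+ 2 = ((m - 2) * e) ^+ 2.
      by rewrite -exprMn; congr (_ ^+ 2); rewrite -subr_sqr expr1n a2; ring.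
    have : (a - 1) ^+ 2 * 4 <= (a - 1) ^+ 2 * (a + 1) ^+ 2.
      by apply: ler_wpM2l; [exact: sqr_ge0 | nra].
    by rewrite exprMn; lra.
  have U : (u - 1) ^+ 2 <= 4 / 9 * ((m - 1) ^+ 2 * e ^+ 2).
    have : (u - 1) ^+ 2 * (u + 1) ^+ 2 = ((m - 1) * e) ^+ 2.
      by rewrite -exprMn -[RHS]sqrrN; congr (_ ^+ 2); rewrite -subr_sqr expr1n u2; ring.
    have : (u - 1) ^+ 2 * (9 / 4) <= (u - 1) ^+ 2 * (u + 1) ^+ 2.
      by apply: ler_wpM2l; [exact: sqr_ge0 | nra].
    by rewrite exprMn; lra.
  rewrite !mulNr opprK !sqrrN -/a -/u a2 u2 te (addrC (- 1) u).
  have e7 : e <= 1 / 7 by have := ler_wpM2r (ltW e0) d7; rewrite e1; lra.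
  have T3 : (1 + t) ^+ 2 * (6 * e - 2) <= 6 * e - 2.
    have : 1 <= (1 + t) ^+ 2 by nra.
    by nra.
  have T1 : (m - 1) * ((1 - a) ^+ 2 * (6 * (1 + (m - 2) * e) - 2))
     <= (m - 1) * ((m - 2) ^+ 2 * e ^+ 2 / 4 * (6 * (1 + (m - 2) * e) - 2)).
    apply: ler_wpM2l; first by lra.
    apply: ler_wpM2r => //; have : 0 <= (m - 2) * e by apply: mulr_ge0; lra.
    by lra.
  have T2 : m * ((u - 1) ^+ 2 * (6 * (1 - (m - 1) * e) - 2))
     <= m * (4 / 9 * ((m - 1) ^+ 2 * e ^+ 2) * (6 * (1 - (m - 1) * e) - 2)).
    by apply: ler_wpM2l; [lra | apply: ler_wpM2r => //; lra].
  suff : (m - 1) * ((m - 2) ^+ 2 * e ^+ 2 / 4 * (6 * (1 + (m - 2) * e) - 2))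
    + m * (4 / 9 * ((m - 1) ^+ 2 * e ^+ 2) * (6 * (1 - (m - 1) * e) - 2))
    + 6 * e - 2 <= - (4 * (1 / 16)) by lra.
  rewrite -subr_ge0.
  have -> : e = den^-1 by [].
  rewrite (_ : _ - _ = ((2 - 1 / 4) * den ^+ 3 - 6 * den ^+ 2
     - (m - 1) * (m - 2) ^+ 2 / 4 * (4 * den + 6 * (m - 2))
     - m * (4 / 9) * (m - 1) ^+ 2 * (4 * den - 6 * (m - 1))) / den ^+ 3); last first.
    by field; rewrite lt0r_neq0.
  apply: divr_ge0; last by rewrite exprn_ge0 // ltW.
  by rewrite /saddle_den; lra.
- rewrite sum_well_saddle // sum_well_pm1; last exact: config_pm1.
  rewrite natrM.
  have : 1 / 16 <= m * (m - 1) / (4 * den).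
    by rewrite ler_pdivlMr ?mulr_gt0 // /saddle_den; lra.
  by lra.
Qed.

Definition link_cost : R := 256 * N%:R ^+ 2 / (1 / 16)
  + 256 * N%:R ^+ 2 / (m * (m - 3) ^+ 2 / (4 * (m + 1) ^+ 2 * den ^+ 2)).

Lemma config_to_relay g h s i : 0 <= g -> config M s -> s 0 i = 1 ->
  saddle_level M g (interfaces s) (defect s i) + link_cost * g ^+ 2 <= h ->
  linked g h s (relay s i).
Proof.
move=> g0 cs si hh.
have m4 := m_ge4 (R := R) M4; have d0 := den_gt0 (R := R) M4.
have N2 : 0 <= 256 * N%:R ^+ 2 :> R by exact: mulr_ge0 (ler0n _ _) (sqr_ge0 _).
have g2 := sqr_ge0 g.
have c1 : 0 <= 256 * N%:R ^+ 2 / (1 / 16) :> R by apply: divr_ge0 => //; lra.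
have c2 : 0 <= 256 * N%:R ^+ 2 / (m * (m - 3) ^+ 2 / (4 * (m + 1) ^+ 2 * den ^+ 2)).
  apply: divr_ge0 => //; apply: divr_ge0.
    by apply: mulr_ge0; [lra | exact: sqr_ge0].
  by apply: mulr_ge0; [apply: mulr_ge0 => // |]; exact: sqr_ge0.
apply: (@linked_trans _ _ _ _ (saddle s i)); first apply: linked_sym.
  apply: linked_le (saddle_to_config g0 cs si); apply: le_trans hh.
  by rewrite lerD2l ler_wpM2r // /link_cost lerDl.
apply: linked_le (saddle_to_relay g0 cs si); apply: le_trans hh.
by rewrite lerD2l ler_wpM2r // /link_cost lerDr.
Qed.

End HalfStep.

(** * Exchanging a particle and a hole *)

Section Chains.
Context {R : realType} {M : nat}.
Local Notation N := (2 * M)%N.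
Local Notation m := (M%:R : R).
Implicit Types (g h : R) (x s : 'rV[R]_N) (i j a b : 'I_N).
Hypothesis M4 : (4 <= M)%N.

Let N1 : (1 < N)%N. Proof. by lia. Qed.
Let pm1F : ((-1 : R) == 1) = false. Proof. exact: negPf pm1_neq. Qed.
Let pm1F' : ((1 : R) == -1) = false. Proof. by rewrite eq_sym pm1F. Qed.

Lemma iter_ordS i a : exists k, iter k (@ordS N) i = a.
Proof.
have v k : iter k (@ordS N) i = ((i + k) %% N)%N :> nat.
  elim: k => [|k IH]; first by rewrite addn0 modn_small.
  by rewrite iterS /= IH addnS -addn1 modnDml addn1.
exists (a + (N - i))%N; apply: val_inj; rewrite /= v.
have -> : (i + (a + (N - i)) = a + N)%N by have := ltn_ord i; lia.
by rewrite modnDr modn_small.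
Qed.

Lemma dirichlet_gt0 x i a : x 0 i <> x 0 a -> 0 < dirichlet x.
Proof.
move=> ia; rewrite lt_neqAle dirichlet_ge0 andbT; apply/eqP => D; apply: ia.
have xS k : x 0 (ordS k) = x 0 k.
  apply/eqP; rewrite -subr_eq0 -sqrf_eq0; apply/eqP.
  have := psumr_eq0P _ (esym D); apply=> // j _; exact: sqr_ge0.
have [k <-] := iter_ordS i a.
by elim: k => //= k IH; rewrite xS.
Qed.

Definition rising s : pred 'I_N := [pred k | (s 0 k == -1) && (s 0 (ordS k) == 1)].

(** Rising and falling interfaces alternate: the increments [s 0 (ordS k) - s 0 k]
    sum to zero around the ring. *)
Lemma interfaces_rising s : pm1 s -> interfaces s = (2 * #|rising s|)%N.
Proof.
move=> p1; apply/eqP; rewrite -(eqr_nat R) natrM; set c := #|_|.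
have : 4 * (interfaces s)%:R = 8 * c%:R :> R.
  rewrite -dirichlet_interfaces //.
  transitivity (dirichlet s + 2 * \sum_k (s 0 (ordS k) - s 0 k)).
    by rewrite sumrB sum_ordS subrr mulr0 addr0.
  have -> : 8 * c%:R = \sum_k (if rising s k then 8 else 0) :> R.
    by rewrite -big_mkcond sumr_const -[RHS]mulr_natr.
  rewrite /dirichlet mulr_sumr -big_split /=; apply: eq_bigr => k _; rewrite /rising /=.
  case: (p1 k) => ->; case: (p1 (ordS k)) => ->; rewrite ?eqxx ?pm1F ?pm1F' /=; ring.
by move=> h; apply/eqP; lra.
Qed.

Lemma interfaces_even s : pm1 s -> ~~ odd (interfaces s).
Proof. by move=> /interfaces_rising ->; rewrite mul2n odd_double. Qed.

Lemma interfaces_ge2 s : config M s -> (2 <= interfaces s)%N.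
Proof.
move=> cs; have [i si] := config_has M4 (or_introl erefl) cs.
have [j sj] := config_has M4 (or_intror erefl) cs.
have ij : s 0 i <> s 0 j by rewrite si sj => /eqP; rewrite pm1F'.
have := dirichlet_gt0 ij; rewrite (dirichlet_interfaces (config_pm1 cs)).
rewrite pmulr_rgt0 // ltr0n; have := interfaces_even (config_pm1 cs).
by case: interfaces => [|[|]].
Qed.

Lemma isolatedN s i : isolated_site (- s) i = isolated_site s i.
Proof. by rewrite /isolated_site /= !mxE !eqr_opp. Qed.

Lemma defect_isolated s i : pm1 s -> isolated_site s i -> defect s i = 4.
Proof.
move=> p1; rewrite /isolated_site /defect /=.
by case: (p1 i) => ->; case: (p1 (ordS i)) => ->; case: (p1 (ord_pred i)) => ->;
  rewrite ?eqxx ?andbF //= => _; ring.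
Qed.

Lemma defect_nonisolated s i : pm1 s -> ~~ isolated_site s i -> defect s i <= 2.
Proof.
move=> p1; rewrite /isolated_site /defect /=.
by case: (p1 i) => ->; case: (p1 (ordS i)) => ->; case: (p1 (ord_pred i)) => ->;
  rewrite ?eqxx ?pm1F ?pm1F' //= => _; lra.
Qed.

Lemma defect_le4 s i : pm1 s -> defect s i <= 4.
Proof.
move=> p1; have [/(defect_isolated p1) -> //|] := boolP (isolated_site s i).
by move=> /(defect_nonisolated p1); lra.
Qed.

Lemma sum_defect s : pm1 s -> \sum_k defect s k = 4 * (interfaces s)%:R.
Proof.
move=> p1; rewrite -dirichlet_interfaces // /dirichlet.
transitivity (\sum_k ((1 - s 0 k * s 0 (ordS k)) + (1 - s 0 k * s 0 (ord_pred k)))).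
  by apply: eq_bigr => k _; rewrite /defect; ring.
rewrite big_split /= -[X in _ + X]sum_ordS -big_split /=; apply: eq_bigr => k _.
by rewrite ordSK; case: (p1 k) => ->; case: (p1 (ordS k)) => ->; ring.
Qed.

(** The defects add up to four times the number of interfaces, and each of the
    [N] sites contributes at most 2. *)
Lemma nonisolated_le s : config M s -> ~ (exists i, isolated_site s i) ->
  (interfaces s <= M)%N.
Proof.
move=> cs ni; have p1 := config_pm1 cs; rewrite -(ler_nat R).
have := sum_defect p1.
have : \sum_k defect s k <= \sum_(k < N) 2.
  apply: ler_sum => k _; apply: defect_nonisolated => //.
  by apply/negP => ik; apply: ni; exists k.
by rewrite sumr_const card_ord -[leRHS]mulr_natr natrM; lra.
Qed.

Definition swap s i j : 'rV[R]_N := \row_k s 0 (tperm i j k).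

Lemma swap_config s i j : config M s -> config M (swap s i j).
Proof.
move=> [p1 c1 c2].
have C v : #|[pred k | swap s i j 0 k == v]| = #|[pred k | s 0 k == v]|.
  rewrite -!sum1_card [RHS](reindex_inj (@perm_inj _ (tperm i j))).
  by apply: eq_bigl => k; rewrite !inE mxE.
by split; [move=> k; rewrite mxE; exact: p1 | rewrite C | rewrite C].
Qed.

Lemma swap_upd s i j : s 0 i = 1 -> s 0 j = -1 ->
  swap s i j = upd (upd s i (-1)) j 1.
Proof.
move=> si sj; apply/rowP => k; rewrite mxE !updE.
have [->|kj] := eqVneq k j; first by rewrite tpermR.
have [->|ki] := eqVneq k i; first by rewrite tpermL.
by rewrite tpermD // eq_sym.
Qed.

Lemma relay_swap s i j : s 0 i = 1 -> s 0 j = -1 ->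
  relay (swap s i j) j = relay s i.
Proof.
move=> si sj; rewrite (swap_upd si sj); apply/rowP => k; rewrite !mxE.
have [->|kj] := eqVneq k j; first by rewrite sj pm1F; case: ifP.
by case: (k == i); rewrite ?pm1F.
Qed.

(** Flipping [i], then [j], passes through [relay s i], which is also the relay of
    the result at [j]. The hypothesis says that, once [i] is flipped, [j] sits
    at the edge of a block of holes; the second saddle then has defect 2. *)
Lemma swap_step s i j : config M s -> s 0 i = 1 -> s 0 j = -1 ->
  upd s i (-1) 0 (ordS j) + upd s i (-1) 0 (ord_pred j) = 0 ->
  (interfaces (swap s i j))%:R + defect s i = (interfaces s)%:R + 2 /\
  forall g h, 0 <= g ->
    saddle_level M g (interfaces s) (defect s i) + link_cost (M := M) * g ^+ 2 <= h ->
    saddle_level M g (interfaces (swap s i j)) 2 + link_cost (M := M) * g ^+ 2 <= h ->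
    linked g h s (swap s i j).
Proof.
move=> cs si sj uj; have cs' := swap_config i j cs.
set s' := swap s i j in cs' *; set u := upd s i (-1) in uj.
have uj1 : u 0 j = -1 by rewrite updE sj; case: ifP.
have lap_i : lap s i = defect s i by rewrite /lap /defect si; ring.
have s'j : s' 0 j = 1 by rewrite /s' (swap_upd si sj) updE eqxx.
have dj : defect s' j = 2.
  rewrite /defect s'j /s' (swap_upd si sj) -/u !(updE u).
  by rewrite (negPf (ordS_neq j N1)) (negPf (ord_pred_neq j N1)) uj; ring.
split.
  have := dirichlet_interfaces (config_pm1 cs').
  rewrite /s' (swap_upd si sj) -/u dirichlet_upd // /u dirichlet_upd // -/u.
  rewrite (dirichlet_interfaces (config_pm1 cs)) uj1 si lap_i.
  have -> : lap u j = -2 by rewrite /lap uj1; lra.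
  by lra.
move=> g h g0 h1 h2; apply: (@linked_trans _ _ _ _ (relay s i)).
  exact: config_to_relay.
apply: linked_sym; rewrite -(relay_swap si sj) -/s'.
by apply: config_to_relay => //; rewrite dj.
Qed.

(** Flipping an isolated particle merges two blocks of holes and removes two
    interfaces. The lost particle is restored at the right edge of the merged
    block, found by walking from [i] to the next particle. This second saddle
    is no higher than the first, as [M >= 3]. *)
Lemma isolated_plus_step s i : config M s -> isolated_site s i -> s 0 i = 1 ->
  exists s', [/\ config M s', (interfaces s' + 2 = interfaces s)%N
    & forall g h, 0 <= g ->
       saddle_level M g (interfaces s) 4 + link_cost (M := M) * g ^+ 2 <= h ->
       linked g h s s'].
Proof.
move=> cs iso si; have p1 := config_pm1 cs.
have di := defect_isolated p1 iso.
have [sS sP] : s 0 (ordS i) = -1 /\ s 0 (ord_pred i) = -1.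
  move: iso; rewrite /isolated_site /= si => /andP[].
  by case: (p1 (ordS i)) => ->; case: (p1 (ord_pred i)) => ->; rewrite ?eqxx.
pose u := upd s i (-1).
have up1 k : u 0 k = 1 \/ u 0 k = -1.
  by rewrite updE; case: ifP => _; [right | exact: p1].
have [a ai sa] : exists2 a, a != i & s 0 a = 1.
  have [_ + _] := cs; rewrite (cardD1 i) inE si eqxx.
  case: (pickP [predD1 [pred k | s 0 k == 1] & i]) => [a|E].
    by rewrite !inE => /andP[ai /eqP sa] _; exists a.
  by rewrite (eq_card0 E) => c1; lia.
have ex : exists k, u 0 (iter k (@ordS N) i) == 1.
  by have [k ki] := iter_ordS i a; exists k; rewrite ki updE (negPf ai) sa.
case: (ex_minnP ex) => -[|[|k]].
- by rewrite /= updE eqxx pm1F.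
- by rewrite /= updE (negPf (ordS_neq i N1)) sS pm1F.
rewrite [iter _ _ _]/=; set b := iter k (@ordS N) i => /eqP ub kmin.
have uSb : u 0 (ordS b) = -1.
  case: (up1 (ordS b)) => // /eqP h; have := kmin k.+1.
  by rewrite iterS -/b h => /(_ isT); rewrite ltnn.
have ubb : u 0 b = -1.
  by case: (up1 b) => // /eqP h; have := kmin k; rewrite -/b h => /(_ isT); lia.
have sSb : s 0 (ordS b) = -1.
  move: uSb; rewrite updE; case: eqP => // E _.
  have := ub; rewrite E updE (negPf (ordS_neq i N1)) sS => /eqP; by rewrite pm1F.
exists (swap s i (ordS b)).
have [|pE L] := swap_step cs si sSb.
  by rewrite -/u ordSK ub ubb subrr.
have pN : (interfaces (swap s i (ordS b)) + 2 = interfaces s)%N.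
  by apply/eqP; rewrite -(eqr_nat R) natrD; apply/eqP; lra.
split=> //; first exact: swap_config.
move=> g h g0 hh; apply: L => //; first by rewrite di.
apply: le_trans hh; rewrite lerD2r -pN /saddle_level lerD2l.
have m4 := m_ge4 (R := R) M4; have d0 := den_gt0 (R := R) M4.
apply: ler_wpM2l; first by apply: divr_ge0 => //; apply: mulr_ge0 => //; exact: ltW.
rewrite natrD; set p := (interfaces _)%:R.
have : 0 <= (2 * m - 3) * (2 * m - 6) by apply: mulr_ge0; lra.
by lra.
Qed.

Lemma isolated_step s i : config M s -> isolated_site s i ->
  exists s', [/\ config M s', (interfaces s' + 2 = interfaces s)%N
    & forall g h, 0 <= g ->
       saddle_level M g (interfaces s) 4 + link_cost (M := M) * g ^+ 2 <= h ->
       linked g h s s'].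
Proof.
move=> cs iso; case: (config_pm1 cs i) => si.
  exact: isolated_plus_step iso si.
have [||s' [cs' pE L]] := isolated_plus_step (configN cs) (i := i).
- by rewrite isolatedN.
- by rewrite mxE si opprK.
exists (- s'); rewrite !interfacesN in pE L *; split=> //; first exact: configN.
by move=> g h g0 hh; apply: linked_opp; rewrite opprK; exact: L.
Qed.

Lemma isolated_ge4 s i : config M s -> isolated_site s i -> (4 <= interfaces s)%N.
Proof.
by move=> cs /(isolated_step cs)[s' [/interfaces_ge2 + <- _]]; lia.
Qed.

Lemma saddle_level_mono g p p' (d : R) : 0 <= g -> (p <= p')%N ->
  saddle_level M g p d <= saddle_level M g p' d.
Proof.
move=> g0 pp; rewrite /saddle_level lerD2l; apply: ler_wpM2l.
  have d0 := den_gt0 (R := R) M4.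
  by apply: divr_ge0 => //; apply: mulr_ge0 => //; exact: ltW.
by rewrite lerD2r lerD2r; apply: ler_wpM2l; [exact: sqr_ge0 | rewrite ler_nat].
Qed.

(** Isolated sites are removed one at a time, through lower and lower saddles. *)
Lemma descend s i : config M s -> isolated_site s i ->
  exists s', [/\ config M s', (interfaces s' < interfaces s)%N,
      ~ (exists k, isolated_site s' k)
    & forall g h, 0 <= g ->
       saddle_level M g (interfaces s) 4 + link_cost (M := M) * g ^+ 2 <= h ->
       linked g h s s'].
Proof.
have [n] := ubnP (interfaces s); elim: n s i => // n IH s i pn cs iso.
have [s1 [cs1 p1 L1]] := isolated_step cs iso.
have [[k isk]|ni] := pselect (exists k, isolated_site s1 k); last first.
  by exists s1; split=> //; lia.
have [|s2 [cs2 p2 ni2 L2]] := IH s1 k _ cs1 isk; first by lia.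
exists s2; split=> //; first by lia.
move=> g h g0 hh; apply: (@linked_trans _ _ _ _ s1); first exact: L1.
apply: L2 => //; apply: le_trans hh; rewrite lerD2r.
by apply: saddle_level_mono => //; lia.
Qed.

(** One particle moves from the left end [i] of its block to the left end of
    another block, extending that one to the site [b]. *)
Lemma edge_step s i b : config M s -> ~ (exists k, isolated_site s k) ->
  s 0 (ord_pred i) = -1 -> s 0 i = 1 -> b != ord_pred i ->
  s 0 b = -1 -> s 0 (ordS b) = 1 ->
  [/\ interfaces (swap s i b) = interfaces s,
      s 0 (ordS i) = 1 & forall g h, 0 <= g ->
       saddle_level M g (interfaces s) 2 + link_cost (M := M) * g ^+ 2 <= h ->
       linked g h s (swap s i b)].
Proof.
move=> cs ni sP si bi sb sSb; have p1 := config_pm1 cs.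
have sS : s 0 (ordS i) = 1.
  case: (p1 (ordS i)) => // h; case: ni; exists i.
  by rewrite /isolated_site /= sP si h pm1F.
have sPb : s 0 (ord_pred b) = -1.
  case: (p1 (ord_pred b)) => // h; case: ni; exists b.
  by rewrite /isolated_site /= sb sSb h pm1F'.
have di : defect s i = 2 by rewrite /defect si sS sP; ring.
have [|pE L] := swap_step cs si sb.
  rewrite !updE sPb if_same.
  have -> : (ordS b == i) = false.
    by apply/negP => /eqP E; move: bi; rewrite -E ordSK eqxx.
  by rewrite sSb subrr.
have pN : interfaces (swap s i b) = interfaces s.
  by apply/eqP; rewrite -(eqr_nat R); apply/eqP; lra.
by split=> // g h g0 hh; apply: L => //; rewrite ?di ?pN.
Qed.

(** Repeating [edge_step] shrinks the block starting at [i], whose length is at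
    most [n], until some site becomes isolated. The number of interfaces, hence
    the level of the saddles, does not change on the way. *)
Lemma reach_isolated n s i : config M s -> ~ (exists k, isolated_site s k) ->
  (4 <= interfaces s)%N -> s 0 (ord_pred i) = -1 -> s 0 i = 1 ->
  (exists2 k, (k <= n)%N & s 0 (iter k (@ordS N) i) = -1) ->
  exists s', [/\ config M s', interfaces s' = interfaces s,
      exists k, isolated_site s' k
    & forall g h, 0 <= g ->
       saddle_level M g (interfaces s) 2 + link_cost (M := M) * g ^+ 2 <= h ->
       linked g h s s'].
Proof.
elim: n s i => [|n IH] s i cs ni p4 sP si [k kn sk].
  by move: kn sk; rewrite leqn0 => /eqP -> /=; rewrite si => /eqP; rewrite pm1F'.
have p1 := config_pm1 cs.
have [b bi [sb sSb]] : exists2 b, b != ord_pred i & s 0 b = -1 /\ s 0 (ordS b) = 1.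
  have := interfaces_rising p1; rewrite (cardD1 (ord_pred i)).
  case: (pickP [predD1 rising s & ord_pred i]) => [b|E].
    by rewrite !inE => /and3P[bi /eqP sb /eqP sSb] _; exists b.
  by rewrite (eq_card0 E); case: (_ \in _); lia.
have [pE sS L] := edge_step cs ni sP si bi sb sSb.
set s' := swap s i b in pE L.
have cs' : config M s' by exact: swap_config.
have [iso|ni'] := pselect (exists k, isolated_site s' k).
  by exists s'; split.
have bE a : s 0 a = 1 -> (a == b) = false.
  by move=> sa; apply/negP => /eqP E; move: sb; rewrite -E sa => /eqP; rewrite pm1F'.
have s'E a : s' 0 a = if a == b then 1 else if a == i then -1 else s 0 a.
  by rewrite /s' (swap_upd si sb) !updE.
have [||||s2 [cs2 pE2 iso2 L2]] := IH s' (ordS i) cs' ni'.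
- by rewrite pE.
- by rewrite ordSK s'E (bE i si) eqxx.
- by rewrite s'E (bE _ sS) (negPf (ordS_neq i N1)) sS.
- have k2 : (1 < k)%N.
    by case: k sk {kn} => [|[|k]] //=; rewrite ?si ?sS => /eqP; rewrite pm1F'.
  have itS q : iter q (@ordS N) (ordS i) = iter q.+1 (@ordS N) i by rewrite iterSr.
  (* The particle may have been moved onto the hole that ended the run; its left
     neighbour, one step earlier, is then also a hole. *)
  have [E|nE] := eqVneq (iter k (@ordS N) i) b.
    have sPb : s 0 (ord_pred b) = -1.
      case: (p1 (ord_pred b)) => // h; case: ni; exists b.
      by rewrite /isolated_site /= sb sSb h pm1F'.
    exists (k.-2)%N; first by lia.
    have kE : k = k.-2.+2 by lia.
    have E' : iter k.-2.+1 (@ordS N) i = ord_pred b by rewrite -E [in RHS]kE iterS ordSK.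
    rewrite itS E' s'E sPb; case: eqVneq => [Eb|_]; last by rewrite if_same.
    by move: (ord_pred_neq b N1); rewrite Eb eqxx.
  exists (k.-1)%N; first by lia.
  have kE : k = k.-1.+1 by lia.
  by rewrite itS -kE s'E (negPf nE) sk if_same.
exists s2; split=> //; first by rewrite pE2.
move=> g h g0 hh; apply: (@linked_trans _ _ _ _ s'); first exact: L.
by apply: L2 => //; rewrite pE.
Qed.

(** Once a block has been shrunk to an isolated site, [descend] takes over, at
    levels below those of the edge saddles. *)
Lemma coarsen s : config M s -> ~ (exists k, isolated_site s k) ->
  (4 <= interfaces s)%N ->
  exists s', [/\ config M s', (interfaces s' < interfaces s)%N,
      ~ (exists k, isolated_site s' k)
    & forall g h, 0 <= g ->
       saddle_level M g (interfaces s) 2 + link_cost (M := M) * g ^+ 2 <= h ->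
       linked g h s s'].
Proof.
move=> cs ni p4; have p1 := config_pm1 cs.
have /card_gt0P[b] : (0 < #|rising s|)%N.
  by have := interfaces_rising p1; lia.
rewrite inE => /andP[/eqP sb /eqP sSb].
have [k kE] := iter_ordS (ordS b) b.
have [|||s1 [cs1 pE [j iso] L1]] := @reach_isolated k s (ordS b) cs ni p4.
- by rewrite ordSK.
- by [].
- by exists k => //; rewrite kE.
have [s2 [cs2 p2 ni2 L2]] := descend cs1 iso.
exists s2; split=> //; first by rewrite -pE.
move=> g h g0 hh; apply: (@linked_trans _ _ _ _ s1); first exact: L1.
apply: L2 => //; apply: le_trans hh; rewrite lerD2r pE.
by apply: saddle_level_le => //; lra.
Qed.

End Chains.

(** * Metastable order *)

Section Keys.
Context {R : realType} {M : nat}.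
Local Notation N := (2 * M)%N.
Local Notation m := (M%:R : R).
Local Notation den := (@saddle_den R M).
Implicit Types (g h : R) (x y s : 'rV[R]_N) (q : nat * bool).
Hypothesis M4 : (4 <= M)%N.

Definition key s : nat * bool := (interfaces s, `[< exists i, isolated_site s i >]).

(** The order of decreasing barriers, by [barrier_lt]. *)
Definition key_lt q q' := (q.2 < q'.2)%N || (q.2 == q'.2) && (q.1 < q'.1)%N.

Definition key_defect q : R := if q.2 then 4 else 2.

Definition family g q : set 'rV[R]_N :=
  continuation g @` [set s | config M s /\ key s = q].

Definition keys : seq (nat * bool) :=
  (2, false)%N :: [seq (p, false) | p <- evens 4 M] ++ [seq (p, true) | p <- evens 4 N].

Lemma mem_evens a b p : (p \in evens a b) = [&& ~~ odd p, a <= p & p <= b]%N.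
Proof. by rewrite mem_filter mem_index_iota ltnS. Qed.

Lemma pairwise_evens a b : pairwise ltn (evens a b).
Proof.
rewrite -sorted_pairwise; last exact: ltn_trans.
by apply: sorted_filter; [exact: ltn_trans | exact: iota_ltn_sorted].
Qed.

Lemma pairwise_keys : pairwise key_lt keys.
Proof.
rewrite /keys pairwise_cons pairwise_cat all_cat !pairwise_map !all_map.
have P b : pairwise (relpre (fun p => (p, b)) key_lt) (evens 4 (if b then N else M)).
  apply: sub_pairwise (pairwise_evens _ _) => p p' pp.
  by rewrite /key_lt /= ltnn eqxx.
rewrite -!andbA; apply/and5P; split; [| | | exact: P false | exact: P true].
- by apply/allP => p; rewrite mem_evens => /and3P[_ p4 _]; rewrite /key_lt /=; lia.
- by apply/allP.
- by apply/allrelP => ? ? /mapP[p _ ->] /mapP[p' _ ->].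
Qed.

Lemma key_lt_asym q q' : key_lt q q' -> key_lt q' q = false.
Proof. by rewrite /key_lt; case: q => p [] /=; case: q' => p' [] /=; lia. Qed.

Lemma key_lt_nth i j q0 : (i < size keys)%N -> (j < size keys)%N ->
  key_lt (nth q0 keys i) (nth q0 keys j) = (i < j)%N.
Proof.
move=> iL jL; have K := pairwiseP q0 pairwise_keys.
have [ij|ji|->] := ltngtP i j; first exact: K.
  by apply: key_lt_asym; exact: K.
by apply/negP => h; have := key_lt_asym h; rewrite h.
Qed.

Lemma keys_uniq : uniq keys.
Proof.
apply: pairwise_uniq pairwise_keys.
by move=> q; apply/negP => h; have := key_lt_asym h; rewrite h.
Qed.

Lemma key_in s : config M s -> key s \in keys.
Proof.
move=> cs; have p1 := config_pm1 cs.
have ev := interfaces_even p1; have p2 := interfaces_ge2 M4 cs.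
rewrite /keys /key inE mem_cat; case: asboolP => [[i iso]|ni].
  apply/orP; right; apply/orP; right; apply: map_f.
  rewrite mem_evens ev (isolated_ge4 M4 cs iso) /=.
  by rewrite -[leqRHS]card_ord max_card.
have pM := nonisolated_le cs ni.
have [->|pn2] := eqVneq (interfaces s) 2%N; first by rewrite eqxx.
apply/orP; right; apply/orP; left; apply: map_f.
by rewrite mem_evens ev pM andbT /=; case: interfaces p2 pn2 ev => [|[|[|[]]]].
Qed.

(** Any configuration outside the first family reaches an earlier one through
    saddles no higher, up to order [g ^+ 2], than the lowest one around it. *)
Lemma key_relax s : config M s -> key s != (2%N, false) ->
  exists s', [/\ config M s', key_lt (key s') (key s)
    & forall g h, 0 <= g ->
       saddle_level M g (key s).1 (key_defect (key s)) + link_cost (M := M) * g ^+ 2 <= h ->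
       linked g h s s'].
Proof.
move=> cs; rewrite /key /key_defect /=; case: asboolP => [[i iso] _|ni p2].
  have [s' [cs' ps ni' L]] := descend M4 cs iso.
  by exists s'; split=> //; rewrite /key_lt /= (asboolF ni').
have p4 : (4 <= interfaces s)%N.
  have ev := interfaces_even (config_pm1 cs); have := interfaces_ge2 M4 cs.
  have : (interfaces s != 2)%N by apply: contraNneq p2 => ->.
  by case: interfaces ev => [|[|[|[]]]].
have [s' [cs' ps ni' L]] := coarsen M4 cs ni p4.
by exists s'; split=> //; rewrite /key_lt /= (asboolF ni') /= ps.
Qed.

Lemma key_defect_ge s i : config M s -> defect s i <= key_defect (key s).
Proof.
move=> cs; have p1 := config_pm1 cs; rewrite /key_defect /key /=.
case: asboolP => [_|ni]; first exact: defect_le4.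
by apply: defect_nonisolated => //; apply/negP => iso; apply: ni; exists i.
Qed.

Lemma family_A'E g p : A'_ N g M p = family g (p, false).
Proof.
congr (_ @` _); apply/seteqP; split=> s.
  by move=> [cs ps ni]; split=> //; rewrite /key ps (asboolF ni).
move=> [cs [ps h]]; split=> //.
by move=> iso; move: h; rewrite asboolT.
Qed.

(** For [p > M] the isolated site is automatic, by [nonisolated_le]. *)
Lemma family_AE g p : (4 <= p)%N -> A_ N g M p = family g (p, true).
Proof.
move=> p4; congr (_ @` _); apply/seteqP; split=> s.
  move=> [cs ps h]; split=> //; rewrite /key ps asboolT //.
  have [pM|Mp] := leqP p M; first by apply: h; rewrite p4.
  apply: contrapT => ni; have := nonisolated_le cs ni; lia.
by move=> [cs [ps /asboolP h]]; split.
Qed.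

Lemma family_A2E g : A_ N g M 2 = family g (2%N, false).
Proof.
congr (_ @` _); apply/seteqP; split=> s.
  move=> [cs ps _]; split=> //; rewrite /key ps asboolF //.
  by move=> [i iso]; have := isolated_ge4 M4 cs iso; rewrite ps.
by move=> [cs [ps h]]; split=> // /andP[].
Qed.

Lemma continuation_inj g s s' : 0 <= g -> 2 * g * N%:R < 1 / 64 ->
  config M s -> config M s' -> continuation g s = continuation g s' -> s = s'.
Proof.
move=> g0 gN cs cs' E; apply/rowP => k.
have [_ _ /(_ k) c _] := continuationP g0 gN (config_pm1 cs) (config_zero_sum cs).
have [_ _ /(_ k) c' _] := continuationP g0 gN (config_pm1 cs') (config_zero_sum cs').
move: c c'; rewrite E !ltr_norml.
by case: (config_pm1 cs k) => ->; case: (config_pm1 cs' k) => -> //; lra.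
Qed.

Lemma potential_config g s : config M s ->
  potential g s = g * (interfaces s)%:R - m / 2.
Proof.
move=> /config_pm1 p1; rewrite potentialE sum_well_pm1 // dirichlet_interfaces // natrM.
by field.
Qed.

Lemma linked_ends g h x y : linked g h x y -> potential g x <= h /\ potential g y <= h.
Proof.
move=> [G _ [G0 G1 GP]]; rewrite -G0 -G1.
by split; [have [] := GP 0 | have [] := GP 1]; rewrite ?lexx ?ler01.
Qed.

(** Collects the errors of order [g ^+ 2] made on both sides of the comparison. *)
Definition coupling_cost : R := link_cost (M := M) + 2 * N%:R + 12 * m * den.

Definition small_coupling g :=
  [/\ 0 < g, 2 * g * N%:R < 1 / 64, weak_coupling (M := M) g & 
      coupling_cost * g <= 2 / (4 * den)].

(** Communication height of a minimum with key [q], up to order [g ^+ 2]. *)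
Definition barrier g q : R := m * (m - 1) / (4 * den)
  + g / (4 * den) * (2 * m ^+ 2 - 3 * q.1%:R - key_defect q * (m * (2 * m - 3))).

Lemma barrierE g q :
  saddle_level M g q.1 (key_defect q) - (g * q.1%:R - m / 2) = barrier g q.
Proof.
have d0 := lt0r_neq0 (den_gt0 (R := R) M4).
rewrite /barrier /saddle_level.
rewrite (_ : 3 * q.1%:R = 4 * den * q.1%:R - (2 * m - 3) ^+ 2 * q.1%:R); last first.
  by rewrite /saddle_den; ring.
by field.
Qed.

(** Each additional interface lowers the barrier by 3 units, and an isolated site
    lowers it by [2 * M * (2 * M - 3)] units, more than [N] interfaces can make
    up for. *)
Lemma barrier_lt g q q' : 0 <= g -> (q.1 <= N)%N -> key_lt q q' ->
  barrier g q' + 3 * (g / (4 * den)) <= barrier g q.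
Proof.
move=> g0 qN lt; have m4 := m_ge4 (R := R) M4; have d0 := den_gt0 (R := R) M4.
rewrite (_ : _ + _ = m * (m - 1) / (4 * den) + g / (4 * den) * (2 * m ^+ 2
  - 3 * q'.1%:R - key_defect q' * (m * (2 * m - 3)) + 3)); last by rewrite /barrier; ring.
rewrite /barrier lerD2l; apply: ler_wpM2l.
  by apply: divr_ge0 => //; apply: mulr_ge0 => //; exact: ltW.
have mm : 16 <= m * m by nra.
have q0 : 0 <= q'.1%:R :> R by [].
have qm : q.1%:R <= 2 * m by rewrite -natrM ler_nat.
move: lt; rewrite /key_lt /key_defect; case: q qN qm => p b; case: q' q0 => p' b' /=.
move=> p0 _ pm /orP[|/andP[/eqP <- pp]].
  by case: b b' => [] [] //= _; nra.
have : p%:R + 1 <= p'%:R :> R by rewrite natr1 ler_nat.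
by case: ifP => _; lra.
Qed.

Lemma comm_height_family_le g q A s s' : small_coupling g ->
  config M s -> config M s' -> key s = q ->
  (forall g h, 0 <= g ->
     saddle_level M g q.1 (key_defect q) + link_cost (M := M) * g ^+ 2 <= h ->
     linked g h s s') ->
  A (continuation g s') ->
  (comm_height g (continuation g s) A
   <= (barrier g q + (link_cost (M := M) + 2 * N%:R) * g ^+ 2)%:E)%E.
Proof.
move=> [/ltW g0 gN _ _] cs cs' kq L As'.
have p1 := config_pm1 cs; have sz := config_zero_sum cs.
have p1' := config_pm1 cs'; have sz' := config_zero_sum cs'.
have [_ b _ _] := continuationP g0 gN p1 sz.
have := L g _ g0 (lexx _); set h := (X in linked _ X) => Lss.
have [sh s'h] := linked_ends Lss.
have Lc : linked g h (continuation g s) (continuation g s').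
  apply: linked_trans (linked_le sh (linked_continuation g0 gN p1 sz)) _.
  apply: linked_trans Lss _; apply: linked_sym.
  exact: linked_le s'h (linked_continuation g0 gN p1' sz').
apply: le_trans (comm_height_le Lc As') _; rewrite lee_fin.
have := potential_well_ge g0 p1 b; rewrite potential_config //.
have -> : interfaces s = q.1 by rewrite -kq.
by rewrite -barrierE /h; lra.
Qed.

Lemma comm_height_family_ge g q A s : small_coupling g -> config M s -> key s = q ->
  (forall z, A z -> exists s', [/\ config M s', s <> s' & z = continuation g s']) ->
  ((barrier g q - 12 * m * den * g ^+ 2)%:E <= comm_height g (continuation g s) A)%E.
Proof.
move=> [/ltW g0 gN gw _] cs kq hA.
have p1 := config_pm1 cs; have sz := config_zero_sum cs.
have [_ _ c8 Vs] := continuationP g0 gN p1 sz.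
have G : forall G, paths (continuation g s) A G -> exists2 r, 0 <= r <= 1 &
    saddle_level M g q.1 (key_defect q) - 12 * m * den * g ^+ 2 <= potential g (G r).
  move=> G [cG zG G0 /hA[s' [cs' ss' G1]]].
  have [_ _ c8' _] := continuationP g0 gN (config_pm1 cs') (config_zero_sum cs').
  have d0 : 0 <= key_defect q by rewrite /key_defect; case: ifP.
  have dl i : defect s i <= key_defect q by rewrite -kq; exact: key_defect_ge.
  have -> : q.1 = interfaces s by rewrite -kq.
  apply: (exit_level M4 g0 gw cs cs' ss' d0 dl) => //.
  - by rewrite G0.
  - by rewrite G1.
apply: le_trans (comm_height_ge G); rewrite lee_fin -barrierE.
move: Vs; rewrite (potential_config g cs).
have -> : interfaces s = q.1 by rewrite -kq.
by lra.
Qed.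

Lemma metastable_order_keys g : small_coupling g ->
  metastable_order g (B_0 N g M) [seq family g q | q <- keys].
Proof.
move=> sg; have [/ltW g0 gN gw gc] := sg.
have d0 := den_gt0 (R := R) M4.
have nthE i : (i < size keys)%N ->
    nth set0 [seq family g q | q <- keys] i = family g (nth (0%N, false) keys i).
  by move=> iL; rewrite (nth_map (0%N, false)).
rewrite /metastable_order size_map; split.
- move=> _ [s cs <-].
  by have [] := continuationP g0 gN (config_pm1 cs) (config_zero_sum cs).
- apply/seteqP; split=> x.
    by move=> [i /= iL]; rewrite nthE // => -[s [cs _] <-]; exists s.
  move=> [s cs <-]; have kL := key_in cs.
  have iL : (index (key s) keys < size keys)%N by rewrite index_mem.
  by exists (index (key s) keys); rewrite // nthE // nth_index //; exists s.
- move=> i j ii jj [x []].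
  have iL : (i < size keys)%N by exact: ii.
  have jL : (j < size keys)%N by exact: jj.
  rewrite !nthE // => -[s [cs ks] <-] [s' [cs' ks'] E].
  have ss' := continuation_inj g0 gN cs' cs E; apply/eqP.
  by rewrite -(nth_uniq (0%N, false) iL jL keys_uniq) -ks -ks' ss'.
exists (g / (4 * den)); first by case: sg => gp _ _ _; rewrite divr_gt0 // mulr_gt0.
move=> k /andP[k0 kL] x; rewrite nthE // => -[s [cs ks] <-] l lk.
have lL : (l < size keys)%N := ltn_trans lk kL.
set q := nth _ keys k in ks; pose q' := nth (0%N, false) keys l.
have kn : key s != (2%N, false).
  rewrite ks -[X in _ != X]/(nth (0%N, false) keys 0) nth_uniq ?keys_uniq //.
  by rewrite -lt0n.
have [s' [cs' lt L]] := key_relax cs kn.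
have UB := comm_height_family_le (A := \bigcup_(i in `I_k) nth set0 [seq family g q | q <- keys] i)
  sg cs cs' ks _ _.
rewrite leeBrDr //; apply: le_ereal_inf_tmp => _ [y + <-].
rewrite nthE // -/q' => -[sy [cy ky] <-].
apply: (@le_trans _ _ (barrier g q - (- (link_cost (M := M) + 2 * N%:R) * g ^+ 2) + g / (4 * den))%:E).
  rewrite EFinD leeD2r // mulNr opprK; apply: UB; first by rewrite -ks.
  have k'L := key_in cs'.
  have iL : (index (key s') keys < size keys)%N by rewrite index_mem.
  have ik : (index (key s') keys < k)%N.
    by rewrite -(key_lt_nth (0%N, false)) // nth_index // -/q -ks.
  by exists (index (key s') keys); rewrite // nthE // nth_index //; exists s'.
apply: le_trans (comm_height_family_ge sg cy ky _); last first.
  move=> z [[i ik]]; rewrite nthE; last exact: leq_trans (_ : i < k.+1)%N kL.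
  move=> [sz [cz kz] <-] nl; exists sz; split=> // E; apply: nl.
  by exists sz; rewrite // -ky E.
rewrite lee_fin.
have qq : key_lt q' q by rewrite key_lt_nth.
have q'N : (q'.1 <= N)%N by rewrite -ky /= -[leqRHS]card_ord max_card.
have := barrier_lt g0 q'N qq.
have : coupling_cost * g * g <= 2 / (4 * den) * g by rewrite ler_wpM2r.
by rewrite /coupling_cost; lra.
Qed.

Lemma small_couplingP :
  exists2 g0 : R, 0 < g0 & forall g, 0 < g < g0 -> small_coupling g.
Proof.
have m4 := m_ge4 (R := R) M4; have d0 := den_gt0 (R := R) M4.
have bound (a b : R) : 0 <= a -> 0 < b -> exists2 g0, 0 < g0 & forall g, 0 < g < g0 -> a * g < b.
  move=> a0 b0; exists (b / (a + 1)); first by rewrite divr_gt0 //; lra.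
  move=> g /andP[gp]; rewrite ltr_pdivlMr; last by lra.
  by nra.
have N0 : 0 <= (2 * M)%N%:R :> R by [].
have K0 : 0 <= ((2 * m - 3) ^+ 2 * (2 * m) + 2 * m ^+ 2) / (4 * den).
  apply: divr_ge0; last by apply: mulr_ge0 => //; exact: ltW.
  by apply: addr_ge0; apply: mulr_ge0; rewrite ?sqr_ge0 //; lra.
have C0 : 0 <= coupling_cost.
  rewrite /coupling_cost /link_cost.
  have c1 : 0 <= 12 * m * den by apply: mulr_ge0; lra.
  have c0 : 0 <= 256 * (2 * M)%N%:R ^+ 2 :> R by exact: mulr_ge0 (ler0n _ _) (sqr_ge0 _).
  have c2 : 0 <= 256 * (2 * M)%N%:R ^+ 2 / (1 / 16) :> R by apply: (divr_ge0 c0); lra.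
  have c3 : 0 <= 256 * (2 * M)%N%:R ^+ 2 / (m * (m - 3) ^+ 2 / (4 * (m + 1) ^+ 2 * den ^+ 2)).
    apply: (divr_ge0 c0); apply: divr_ge0.
      by apply: mulr_ge0; [lra | exact: sqr_ge0].
    exact: mulr_ge0 (mulr_ge0 (ler0n _ _) (sqr_ge0 _)) (sqr_ge0 _).
  move: c1 c2 c3; set a1 := 12 * m * den; set a2 := _ / (1 / 16); set a3 := _ / (_ / _).
  by lra.
have [g1 g10 b1] := bound (2 * (2 * M)%N%:R) (1 / 64) ltac:(lra) ltac:(lra).
have [|g2 g20 b2] := bound _ (1000 * den ^+ 2)^-1 K0.
  by rewrite invr_gt0; exact: mulr_gt0 (ltr0Sn _ _) (exprn_gt0 _ d0).
have [|g3 g30 b3] := bound _ (2 / (4 * den)) C0.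
  by rewrite divr_gt0 // mulr_gt0.
exists (Num.min g1 (Num.min g2 g3)); first by rewrite !lt_min g10 g20 g30.
move=> g /andP[gp]; rewrite !lt_min => /and3P[l1 l2 l3]; split=> //.
- by have := b1 g; rewrite gp l1 => /(_ isT); lra.
- have := b2 g; rewrite gp l2 => /(_ isT) /ltW.
  by rewrite /weak_coupling; congr (_ <= _); field; rewrite lt0r_neq0.
- by apply: ltW; apply: b3; rewrite gp l3.
Qed.

End Keys.

Theorem theorem4p8 (R : realType) (N M M' : nat)
    (N_even : N = (2 * M)%N) (N_ge8 : (8 <= N)%N) (N_not3 : ~~ (3 %| N)%N)
    (M'_def : M' = \max_(p < M.+1 | ~~ odd p) p) :
  exists2 g0 : R, 0 < g0 & forall g : R, 0 < g < g0 ->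
    metastable_order g (B_0 N g M)
      (A_ N g M 2 :: [seq A'_ N g M p | p <- evens 4 M']
                  ++ [seq A_ N g M p | p <- evens 4 N]).
Proof.
subst N; have M4 : (4 <= M)%N by lia.
have evM : evens 4 M' = evens 4 M.
  have M'M : (M' <= M)%N by rewrite M'_def; apply/bigmax_leqP => p _; rewrite -ltnS.
  apply: (irr_sorted_eq ltn_trans ltnn) => [||p].
  - by apply: sorted_filter; [exact: ltn_trans | exact: iota_ltn_sorted].
  - by apply: sorted_filter; [exact: ltn_trans | exact: iota_ltn_sorted].
  rewrite !mem_evens; case: (boolP (odd p)) => //= ev; case: (4 <= p)%N => //=.
  apply/idP/idP => [pM'|pM]; first exact: leq_trans M'M.
  have pM1 : (p < M.+1)%N by [].
  by rewrite M'_def; exact: (leq_bigmax_cond (Ordinal pM1)).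
have [g0 g00 sg] := small_couplingP (R := R) M4.
exists g0 => // g /sg sgg.
have E2 : [seq A'_ (2 * M) g M p | p <- evens 4 M]
    = [seq family g (p, false) | p <- evens 4 M].
  by apply: eq_map => p; rewrite family_A'E.
have E3 : [seq A_ (2 * M) g M p | p <- evens 4 (2 * M)]
    = [seq family g (p, true) | p <- evens 4 (2 * M)].
  by apply/eq_in_map => p; rewrite mem_evens => /and3P[_ p4 _]; rewrite family_AE.
have := metastable_order_keys M4 sgg.
by rewrite /keys map_cons map_cat -!map_comp evM E2 E3 (family_A2E M4).
Qed.
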